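(* Let $r \ge 2$ be a fixed integer and let $\mathcal{H}$ be an $r$-uniform, $D$-regular hypergraph on $N$ vertices, where $D = D(N) \to \infty$ as $N \to \infty$, and suppose that the maximum degree $L = L(N)$ of a pair of distinct vertices in $\mathcal{H}$ satisfies $L = o(D/\log^5 N)$. Run the random greedy matching algorithm on $\mathcal{H}$, let $\mathcal{H}(i)$ be the hypergraph remaining after $i$ steps, on the set $V(i)$ of unsaturated vertices, let $Q(i)$ be the number of edges of $\mathcal{H}(i)$, and for $v \in V(i)$ let $d_v(i)$ be the degree of $v$ in $\mathcal{H}(i)$. Put $p = p(i) = 1 - ir/N$ and \[ e_q = 90 r^2 N L\, p^{2-r} (\log N) \left(1 - r \log p\right)^2, \qquad e_d = \sqrt{6 r L D \log N}\, \left(1 - r \log p\right). \] Let the stopping time $T$ be the first step $i$ such that \[ \left| Q(i) - \frac{ND}{r} p^r \right| > e_q, \quad \text{or} \quad \left| d_v(i) - D p^{r-1} \right| > e_d \ \text{ for some } v \in V(i). \] Then with high probability \[ N - Tr = O\left( N \cdot \left( \frac{L}{D} \right)^{\frac{1}{2(r-1)}} \log^{\frac{5}{2(r-1)}} N \right). \]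
   Context: A hypergraph is $r$-uniform if every edge is a set of $r$ vertices, and $D$-regular if every vertex lies in exactly $D$ edges. The degree of a pair $\{u,v\}$ of distinct vertices is the number of edges containing both $u$ and $v$; $L$ is the maximum of these degrees. A matching is a collection of pairwise disjoint edges. Random greedy matching algorithm on $\mathcal{H}$ (with vertex set $V$): set $\mathcal{M}(0) = \emptyset$, $\mathcal{H}(0) = \mathcal{H}$, $V(0) = V$. In iteration $i \ge 1$, an edge $E_i$ is chosen uniformly at random from the edges of $\mathcal{H}(i-1)$ and added to $\mathcal{M}(i-1)$ to form the matching $\mathcal{M}(i)$; set $V(i) = V(i-1) \setminus E_i$ (so $|V(i)| = N - ir$), and form $\mathcal{H}(i)$ by deleting from $\mathcal{H}(i-1)$ all edges that intersect $E_i$ (including $E_i$ itself). The process terminates at the step $M$ at which $\mathcal{H}(M)$ has no edges. The steps considered in the definition of $T$ are the $i$ with $0 \le i \le M$ and $p(i) > 0$; if none of these steps satisfies either of the two inequalities, set $T = M$. $\log$ is the natural logarithm and $\log^a N = (\log N)^a$. Asymptotics: the statement concerns a sequence of hypergraphs $\mathcal{H} = \mathcal{H}_N$ with $N \to \infty$ and $r$ fixed. ''With high probability'' means with probability tending to $1$ as $N \to \infty$. The conclusion means that there is a constant $C > 0$, not depending on $N$, such that with probability tending to $1$ as $N \to \infty$ one has $N - Tr \le C N (L/D)^{1/(2(r-1))} (\log N)^{5/(2(r-1))}$. *)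

(* Defs.v *)
From HB Require Import structures.
From mathcomp Require Import all_boot all_order all_algebra.
From mathcomp Require Import reals exp.

Set Implicit Arguments.
Unset Strict Implicit.
Unset Printing Implicit Defensive.

Import Order.TTheory GRing.Theory Num.Theory.

Local Open Scope ring_scope.

Lemma big_bseqS (R : zmodType) (T : finType) k (F : seq T -> R) :
  \sum_(s : k.+1.-bseq T) F s = F [::] + \sum_E \sum_(s : k.-bseq T) F (E :: s).
Proof.
pose f (x : option (T * k.-bseq T)) : k.+1.-bseq T :=
  if x is Some (E, s) then [bseq of E :: s] else [bseq of [::]].
have fK : bijective f.
  pose g (s : k.+1.-bseq T) : option (T * k.-bseq T) :=
    if s : seq T is E :: s' then Some (E, insub_bseq k s') else None.
  exists g; first by move=> [[E s]|] //=; rewrite /g /= /insub_bseq valKd.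
  case=> [[|E s] hs]; apply: val_inj => //=.
  by rewrite /insub_bseq insubdK.
rewrite (reindex f) /=; last exact: onW_bij.
rewrite (bigD1 None) //=; congr (_ + _).
rewrite pair_big /= (reindex_omap Some id) /=; last by case.
by apply: eq_big => [[E s]|[E s] _] //=; rewrite eqxx.
Qed.

Section Hypergraphs.
Variable V : finType.
Implicit Types (H : {set {set V}}) (E : {set V}) (u v : V).

Definition uniform (r : nat) H := forall E, E \in H -> #|E| = r.

Definition degree H v : nat := #|[set E in H | v \in E]|.

Definition regular (D : nat) H := forall v, degree H v = D.

Definition pair_degree H u v : nat := #|[set E in H | (u \in E) && (v \in E)]|.

Definition max_pair_degree H : nat :=
  (\max_(u : V) \max_(v : V | u != v) pair_degree H u v)%N.

End Hypergraphs.

(* A run of the random greedy algorithm is recorded as the sequence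
   s = [:: E_1; ...; E_M] of the chosen edges, so that M = size s, the matching
   M(i) is take i s, E_(i+1) is nth set0 s i, H(i) is remaining H s i, and V(i)
   is unsaturated s i. *)
Section RandomGreedyMatching.
Variable V : finType.
Implicit Types (H : {set {set V}}) (E : {set V}) (s : seq {set V}).

(* The edge E is removed separately because the empty set does not intersect
   itself. *)
Definition delete_edge H E : {set {set V}} := [set F in H | [disjoint F & E]] :\ E.

Definition remaining H s (i : nat) : {set {set V}} :=
  foldl delete_edge H (take i s).

Definition unsaturated s (i : nat) : {set V} :=
  foldl (fun U E => U :\: E) [set: V] (take i s).

Definition greedy_run H s : bool :=
  [forall i : 'I_(size s), nth set0 s i \in remaining H s i]
  && (remaining H s (size s) == set0).

Variable R : realType.

(* Given the first i choices, the next edge is uniform on H(i). *)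
Definition run_weight H s : R := \prod_(i < size s) (#|remaining H s i|%:R)^-1.

(* Each step removes at least the chosen edge, so a run has at most #|H| steps. *)
Definition greedy_prob H (A : pred (seq {set V})) : R :=
  \sum_(s : {bseq #|H| of {set V}} | greedy_run H s && A s) run_weight H s.

Lemma remaining0 H s : remaining H s 0 = H.
Proof. by rewrite /remaining take0. Qed.

Lemma remaining_cons H E s i :
  remaining H (E :: s) i.+1 = remaining (delete_edge H E) s i.
Proof. by []. Qed.

Lemma greedy_run_cons H E s :
  greedy_run H (E :: s) = (E \in H) && greedy_run (delete_edge H E) s.
Proof.
rewrite /greedy_run andbA; congr (_ && _).
apply/forallP/andP => /= [h|[hE /forallP h] i].
  split; first by have := h ord0; rewrite remaining0.
  by apply/forallP => i; have := h (lift ord0 i).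
by case: (unliftP ord0 i) => [j ->|->]; [exact: h|rewrite /= remaining0].
Qed.

Lemma run_weight_cons H E s :
  run_weight H (E :: s) = #|H|%:R^-1 * run_weight (delete_edge H E) s.
Proof. by rewrite /run_weight big_ord_recl remaining0. Qed.

Lemma greedy_probT H : greedy_prob H xpredT = 1.
Proof.
rewrite /greedy_prob; under eq_bigl do rewrite andbT.
move: {-1}#|H| (leqnn #|H|) => k; elim: k H => [|k IH] H hk.
  have H0 : H = set0 by apply/eqP; rewrite -cards_eq0 -leqn0.
  rewrite (eq_bigl (pred1 ([bseq] : 0.-bseq {set V}))); last first.
    move=> s; rewrite (bseq0 s) /= eqxx /greedy_run remaining0 H0 eqxx andbT.
    by apply/forallP=> -[].
  by rewrite big_pred1_eq /run_weight big_ord0.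
rewrite big_mkcond
  (big_bseqS k (fun s => if greedy_run H s then run_weight H s else 0)).
have [->|H0] := eqVneq H set0.
  rewrite big1 ?addr0 => [|E _].
    rewrite /greedy_run remaining0 eqxx andbT /run_weight big_ord0.
    by case: ifP => // /forallP[] -[].
  by rewrite big1 // => s _; rewrite greedy_run_cons inE.
rewrite {1}/greedy_run remaining0 (negbTE H0) andbF add0r.
rewrite (eq_bigr (fun E => if E \in H then #|H|%:R^-1 else 0)) => [|E _].
  rewrite -big_mkcond sumr_const -[LHS]mulr_natr mulVf // pnatr_eq0 cards_eq0 //.
under eq_bigr do rewrite greedy_run_cons run_weight_cons.
case: ifP => hE; last by rewrite big1.
rewrite -big_mkcond -mulr_sumr IH ?mulr1 //.
rewrite -ltnS; apply: leq_trans hk; apply: proper_card; apply/properP; split.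
  by apply/subsetP=> F; rewrite !inE => /and3P[].
by exists E => //; rewrite !inE eqxx.
Qed.

Section StoppingTime.
Variables (r D L : nat) (s : seq {set V}) (H : {set {set V}}).

Local Notation N := (#|V|%:R : R).

Definition frac_left (i : nat) : R := 1 - i%:R * r%:R / N.

(* The exponent 2 - r is an integer, possibly negative. *)
Definition err_q (p : R) : R :=
  90 * r%:R ^+ 2 * N * L%:R * p ^ (2%:Z - r%:Z) * ln N
  * (1 - r%:R * ln p) ^+ 2.

Definition err_d (p : R) : R :=
  Num.sqrt (6 * r%:R * L%:R * D%:R * ln N) * (1 - r%:R * ln p).

Definition edges_deviate (i : nat) : bool :=
  let p := frac_left i in
  `|#|remaining H s i|%:R - N * D%:R / r%:R * p ^+ r| > err_q p.

Definition degree_deviates (i : nat) : bool :=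
  let p := frac_left i in
  [exists v in unsaturated s i,
    `|(degree (remaining H s i) v)%:R - D%:R * p ^+ r.-1| > err_d p].

Definition stops_at (i : nat) : bool :=
  (0 < frac_left i) && (edges_deviate i || degree_deviates i).

(* iota 0 (size s).+1 lists the steps 0, ..., M, so the value of find is the
   first of these steps that satisfies stops_at. *)
Definition stopping_time : nat :=
  let steps := iota 0 (size s).+1 in
  if has stops_at steps then find stops_at steps else size s.

End StoppingTime.
End RandomGreedyMatching.

(* Main.v *)
Require Import Defs.
From HB Require Import structures.
From mathcomp Require Import all_boot all_order all_algebra.
From mathcomp Require Import zify ring lra reals sequences exp.

(** Fix p* = C (L/D)^(1/(2(r-1))) (log N)^(5/(2(r-1))) with C large.  As long as
    p > p*, the relative errors e_d / (D p^(r-1)) and e_q r / (N D p^r) are small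
    compared with 1 / (1 - r log p), and it suffices to bound the probability
    that some step with p > p* deviates: if no step deviates, the final step has
    Q = 0, which is a deviation unless p <= p*.

    Every deviation +-(Q - N D p^r / r) - e_q and +-(d_v - D p^(r-1)) - e_d is
    exponentiated.  When the deviation is close to its bound (above e_q / 2,
    respectively above e_d - A / 2 with A = (6 r L D log N)^(1/2)), the
    self-correction of the process together with
    the growth of the error bound makes the exponential a supermartingale; the
    drift is large enough to absorb the second-order terms.  Below that range
    the exponential is at most e N^(-9/4) after one more step.  The sum of these
    2N + 2 exponentials plus |V(i)| (2N + 2) e N^(-9/4) is therefore a
    supermartingale that is at least 1 at a deviating step and O(N^(-1/4))
    initially. *)

Set Implicit Arguments.
Unset Strict Implicit.
Unset Printing Implicit Defensive.

Import Order.TTheory GRing.Theory Num.Theory.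

(** * Counting edges that meet a set *)

Section Counting.
Variable V : finType.
Implicit Types (G B : {set {set V}}) (E F S U : {set V}) (u v w : V).

(** The edges lost when a nonempty [S] joins the matching, see [delete_edge_hitting]. *)
Definition hitting G S : {set {set V}} := [set F in G | ~~ [disjoint F & S]].

Lemma card_setI_sum F S : #|F :&: S| = \sum_(u in S) (u \in F).
Proof.
rewrite -sum1_card big_mkcond [RHS]big_mkcond /=; apply: eq_bigr => u _.
by rewrite inE; case: (u \in F); case: (u \in S).
Qed.

Lemma degree_sum G v : degree G v = \sum_(F in G) (v \in F).
Proof.
rewrite /degree -sum1_card big_mkcond [RHS]big_mkcond /=; apply: eq_bigr => F _.
by rewrite inE; case: (F \in G); case: (v \in F).
Qed.

Lemma pair_degree_sum G u v :
  pair_degree G u v = \sum_(F in G) ((u \in F) && (v \in F)).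
Proof.
rewrite /pair_degree -sum1_card big_mkcond [RHS]big_mkcond /=.
by apply: eq_bigr => F _; rewrite inE; case: (F \in G) => //=; case: (_ && _).
Qed.

Lemma card_hitting G S : #|hitting G S| = \sum_(F in G) (0 < #|F :&: S|).
Proof.
rewrite -sum1_card big_mkcond [RHS]big_mkcond /=; apply: eq_bigr => F _.
rewrite inE -setI_eq0 -cards_eq0 -lt0n.
by case: (F \in G) => //=; case: (0 < _).
Qed.

Lemma sum_degree G S : \sum_(u in S) degree G u = \sum_(F in G) #|F :&: S|.
Proof.
under eq_bigr do rewrite degree_sum.
by rewrite exchange_big; apply: eq_bigr => F _; rewrite card_setI_sum.
Qed.

Lemma hitting_le G S : #|hitting G S| <= \sum_(u in S) degree G u.
Proof.
by rewrite sum_degree card_hitting; apply: leq_sum => F _; case: #|_|.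
Qed.

Lemma sum_card_pairs F S :
  \sum_(u in S) \sum_(w in S | w != u) ((u \in F) && (w \in F))
    = #|F :&: S| * #|F :&: S|.-1.
Proof.
rewrite [LHS](eq_bigr (fun u => (u \in F) * #|F :&: S|.-1)) => [|u uS].
  by rewrite -big_distrl /= -card_setI_sum.
have [uF|uF] := boolP (u \in F); last by rewrite mul0n big1.
have -> : #|F :&: S|.-1 = #|(F :&: S) :\ u|.
  by rewrite (cardsD1 u (F :&: S)) inE uF uS.
rewrite mul1n -sum1_card big_mkcond [RHS]big_mkcond /=.
apply: eq_bigr => w _; rewrite !inE.
by case: (w \in F); case: (w \in S); case: (w != u).
Qed.

(* An edge meeting S in k vertices is counted k times by the degree sum, and
   k - 1 <= k (k - 1) bounds the excess by the ordered pairs in the intersection. *)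
Lemma hitting_ge G S L :
  (forall u w, u != w -> pair_degree G u w <= L) ->
  \sum_(u in S) degree G u <= #|hitting G S| + #|S| * #|S|.-1 * L.
Proof.
move=> hL.
have: \sum_(u in S) \sum_(w in S | w != u) pair_degree G u w
        <= #|S| * #|S|.-1 * L.
  rewrite -mulnA -sum_nat_const; apply: leq_sum => u uS.
  apply: (@leq_trans (\sum_(w in S | w != u) L)).
    by apply: leq_sum => w /andP[_ wu]; rewrite hL // eq_sym.
  rewrite sum_nat_const leq_mul2r; apply/orP; right.
  rewrite (cardsD1 u S) uS /=; apply/eq_leq/eq_card => w.
  by rewrite !inE andbC.
move=> hX; apply: leq_trans (leq_add (leqnn _) hX).
rewrite sum_degree card_hitting.
rewrite (eq_bigr (fun u => \sum_(F in G) \sum_(w in S | w != u)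
    ((u \in F) && (w \in F)))) => [|u _]; last first.
  by under eq_bigr do rewrite pair_degree_sum; rewrite exchange_big.
rewrite exchange_big /= -big_split /=; apply: leq_sum => F _.
rewrite sum_card_pairs; case: #|_| => // k /=.
by rewrite addnC addn1 ltnS mulSn leq_addr.
Qed.

Lemma pair_degreeS G B u v : G \subset B -> pair_degree G u v <= pair_degree B u v.
Proof.
move=> /subsetP GB; apply/subset_leq_card/subsetP => F.
by rewrite !inE => /andP[/GB -> ->].
Qed.

Lemma pair_degree_le_max G u v : u != v -> pair_degree G u v <= max_pair_degree G.
Proof.
move=> uv; rewrite /max_pair_degree.
by apply: (bigop.bigmax_sup u) => //; apply: (bigop.bigmax_sup v).
Qed.

Lemma sum_pair_degree r G v :
  uniform r G -> \sum_(u | u != v) pair_degree G u v = degree G v * r.-1.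
Proof.
move=> ur; under eq_bigr do rewrite pair_degree_sum.
rewrite exchange_big /= degree_sum big_distrl /=; apply: eq_bigr => F FG.
have [vF|vF] := boolP (v \in F); last by rewrite big1 // => u; rewrite andbF.
rewrite mul1n -(ur F FG) (cardsD1 v F) vF /= -sum1_card big_mkcond.
rewrite [RHS]big_mkcond /=; apply: eq_bigr => u _; rewrite !inE andbT.
by case: (u == v); case: (u \in F).
Qed.

(** Double counting of the edges through a fixed vertex and their other vertices. The consequence
    [D <= L N] gives [L > 0] and later keeps [- log p] of order [log N] above the threshold. *)
Lemma degree_le_max_pair_degree r D G :
  1 < r -> uniform r G -> regular D G -> 0 < #|V| ->
  D * r.-1 <= max_pair_degree G * #|V|.
Proof.
move=> r1 ur rD /card_gt0P[v _].
rewrite -(rD v) -(sum_pair_degree v ur).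
apply: (@leq_trans (\sum_(u | u != v) max_pair_degree G)).
  by apply: leq_sum => u uv; exact: pair_degree_le_max.
by rewrite sum_nat_const mulnC leq_mul2l max_card orbT.
Qed.

(** An edge through [v] lost with [E] contains [v] and some vertex of [E], and each such pair lies
    in at most [L] edges. This bounds the one-step degree drop of a surviving vertex. *)
Lemma hitting_pair_le G E v L :
  (forall u w, u != w -> pair_degree G u w <= L) -> v \notin E ->
  #|[set F in hitting G E | v \in F]| <= #|E| * L.
Proof.
move=> hL vE.
have -> : [set F in hitting G E | v \in F] = hitting [set F in G | v \in F] E.
  by apply/setP => F; rewrite !inE andbAC.
apply: leq_trans (hitting_le _ _) _.
rewrite -sum_nat_const; apply: leq_sum => u uE.
apply: leq_trans (hL u v _); last by apply: contraNneq vE => <-.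
by apply/eq_leq/eq_card => F; rewrite !inE -andbA [(v \in F) && _]andbC.
Qed.

Lemma delete_edge_hitting G E : E != set0 -> delete_edge G E = G :\: hitting G E.
Proof.
move=> E0; apply/setP => F; rewrite !inE.
have [FG|] := boolP (F \in G); rewrite /= ?andbF // andbT negbK.
case: eqVneq => //= ->; apply/esym/negbTE.
by rewrite -setI_eq0 setIid.
Qed.

Lemma card_delete_edge G E :
  E != set0 -> #|delete_edge G E| + #|hitting G E| = #|G|.
Proof.
move=> E0; rewrite delete_edge_hitting // addnC.
rewrite -[in RHS](cardsID (hitting G E) G); congr (_ + _).
by apply: eq_card => F; rewrite !inE andbA andbb.
Qed.

Lemma degree_delete_edge G E v : E != set0 ->
  degree (delete_edge G E) v + #|[set F in hitting G E | v \in F]| = degree G v.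
Proof.
move=> E0; rewrite delete_edge_hitting // addnC /degree.
rewrite -[in RHS](cardsID (hitting G E) [set F in G | v \in F]).
congr (_ + _); apply: eq_card => F; rewrite !inE.
  by case: (F \in G); case: (v \in F); rewrite /= ?andbT ?andbF.
by case: (F \in G); case: (v \in F); rewrite /= ?andbT ?andbF.
Qed.

(** Disjointness is symmetric, so the loss at [v] summed over all choices of [E] can be counted from
    the edges [F] through [v], which brings in the degrees of the neighbours of [v]. *)
Lemma sum_hitting_pairs G v :
  \sum_(E in G | v \notin E) #|[set F in hitting G E | v \in F]|
    = \sum_(F in G | v \in F) #|hitting [set E in G | v \notin E] F|.
Proof.
rewrite (eq_bigr (fun E => \sum_(F in G | v \in F) ~~ [disjoint F & E])).
  rewrite exchange_big /=; apply: eq_bigr => F _.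
  rewrite -sum1_card big_mkcond [RHS]big_mkcond /=; apply: eq_bigr => E _.
  rewrite !inE disjoint_sym.
  by case: (E \in G); case: (v \in E); case: [disjoint E & F].
move=> E _; rewrite -sum1_card big_mkcond [RHS]big_mkcond /=.
apply: eq_bigr => F _; rewrite !inE.
by case: (F \in G); case: (v \in F); case: [disjoint F & E].
Qed.

Lemma hitting_avoid G F v : v \in F ->
  hitting [set E in G | v \notin E] F = hitting [set E in G | v \notin E] (F :\ v).
Proof.
move=> vF; apply/setP => E; rewrite !inE.
have [EG|//] := boolP (E \in G); have [//|vE] := boolP (v \in E).
rewrite /= -!setI_eq0; congr (~~ (_ == _)).
apply/setP => u; rewrite !inE; case: eqVneq => //= ->.
by rewrite (negbTE vE).
Qed.

Lemma sum_hitting_pairs_le G v :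
  \sum_(E in G | v \notin E) #|[set F in hitting G E | v \in F]|
    <= \sum_(F in G | v \in F) \sum_(u in F :\ v) degree G u.
Proof.
rewrite sum_hitting_pairs; apply: leq_sum => F /andP[FG vF].
rewrite hitting_avoid //; apply: leq_trans (hitting_le _ _) _.
apply: leq_sum => u _; apply/subset_leq_card/subsetP => E.
by rewrite !inE => /andP[/andP[-> _] ->].
Qed.

(** The degree sum overcounts in two ways: for each [F], edges through [v] and another vertex of [F]
    cost at most [(r - 1) L], and edges meeting [F :\ v] repeatedly cost at most [(r - 1) (r - 2) L]
    by [hitting_ge]. *)
Lemma sum_hitting_pairs_ge G v r L :
  uniform r G -> (forall u w, u != w -> pair_degree G u w <= L) ->
  \sum_(F in G | v \in F) \sum_(u in F :\ v) degree G u
    <= \sum_(E in G | v \notin E) #|[set F in hitting G E | v \in F]|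
       + degree G v * (r ^ 2 * L).
Proof.
move=> ur hL; rewrite sum_hitting_pairs.
have -> : degree G v * (r ^ 2 * L) = \sum_(F in G | v \in F) (r ^ 2 * L).
  rewrite sum_nat_const /degree; congr (_ * _).
  by apply: eq_card => F; rewrite !inE.
rewrite -big_split /=; apply: leq_sum => F /andP[FG vF].
rewrite hitting_avoid //; set G' := [set E in G | v \notin E].
have cF : #|F :\ v| = r.-1 by rewrite -(ur F FG) (cardsD1 v F) vF.
have r0 : 0 < r by rewrite -(ur F FG); apply/card_gt0P; exists v.
have hL' u w : u != w -> pair_degree G' u w <= L.
  move=> uw; apply: leq_trans (hL u w uw); apply: pair_degreeS.
  by apply/subsetP => E; rewrite inE => /andP[].
have h1 : \sum_(u in F :\ v) degree G u
    <= \sum_(u in F :\ v) degree G' u + r.-1 * L.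
  rewrite -cF -sum_nat_const -big_split /=; apply: leq_sum => u uF.
  have uv : u != v by move: uF; rewrite !inE => /andP[].
  apply: leq_trans (leq_add (leqnn _) (hL u v uv)).
  rewrite /degree -[leqLHS](cardsID [set E : {set V} | v \in E]) addnC leq_add //.
    by apply/subset_leq_card/subsetP => E; rewrite !inE => /andP[-> /andP[-> ->]].
  by apply/subset_leq_card/subsetP => E; rewrite !inE => /andP[/andP[-> ->] ->].
apply: leq_trans h1 _.
apply: leq_trans (leq_add (hitting_ge (F :\ v) hL') (leqnn _)) _.
rewrite cF -addnA leq_add2l -mulnDl leq_mul2r; apply/orP; right.
by rewrite -mulnn; case: r r0 {ur cF} => // k _ /=; nia.
Qed.

Lemma sum_degree_uniform G U r :
  uniform r G -> (forall F, F \in G -> F \subset U) ->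
  \sum_(u in U) degree G u = r * #|G|.
Proof.
move=> ur GU; rewrite sum_degree mulnC -sum_nat_const.
by apply: eq_bigr => F FG; rewrite (setIidPl (GU F FG)) ur.
Qed.

(** Up to pair corrections, this is [#|G|] times the expected number of edges lost in one step, so
    the drift of [Q] is governed by the second moment of the degrees. *)
Lemma sum_edge_degrees G U : (forall F, F \in G -> F \subset U) ->
  \sum_(E in G) \sum_(u in E) degree G u = \sum_(u in U) degree G u ^ 2.
Proof.
move=> GU.
rewrite (eq_bigr (fun E => \sum_(u in U) (u \in E) * degree G u)) => [|E EG].
  rewrite exchange_big /=; apply: eq_bigr => u _.
  by rewrite -big_distrl /= -degree_sum.
rewrite big_mkcond [RHS]big_mkcond /=; apply: eq_bigr => u _.
have [uE|uE] := boolP (u \in E); last by rewrite mul0n; case: ifP.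
by rewrite (subsetP (GU E EG)) // mul1n.
Qed.

End Counting.

(** * Pessimistic estimators for the greedy process *)

Local Open Scope ring_scope.

Section GreedyProcess.
Variables (R : realType) (V : finType).
Implicit Types (G H : {set {set V}}) (E U : {set V}) (s : seq {set V}).
Implicit Types (A B : pred (seq {set V})).

Lemma run_weight_ge0 H s : 0 <= run_weight R H s.
Proof. by apply: prodr_ge0 => i _; rewrite invr_ge0 ler0n. Qed.

Lemma greedy_prob_le H A B : (forall s, greedy_run H s -> A s -> B s) ->
  greedy_prob R H A <= greedy_prob R H B.
Proof.
move=> AB; rewrite /greedy_prob big_mkcond [leRHS]big_mkcond /=.
apply: ler_sum => s _; case: ifP => [/andP[gs As]|_].
  by rewrite gs (AB s gs As).
by case: ifP => // _; exact: run_weight_ge0.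
Qed.

Lemma greedy_prob_predC H A : greedy_prob R H A + greedy_prob R H (predC A) = 1.
Proof.
rewrite -(greedy_probT R H) /greedy_prob.
rewrite big_mkcond [X in _ + X]big_mkcond [RHS]big_mkcond -big_split /=.
apply: eq_bigr => s _.
by case: greedy_run; case: (A s); rewrite /= ?addr0 ?add0r.
Qed.

(* [greedy_prob] with the bound on the number of steps decoupled from the
   number of edges, so that it can be computed by recursion on the first step. *)
Definition run_sum k H A : R :=
  \sum_(s : {bseq k of {set V}} | greedy_run H s && A s) run_weight R H s.

Lemma run_sum0 k A : run_sum k set0 A <= (A [::])%:R.
Proof.
have only_nil s : greedy_run set0 s -> s = [::].
  case: s => // E s; by rewrite greedy_run_cons inE.
have nilP (s : {bseq k of {set V}}) : greedy_run set0 s && A s ->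
    s = [bseq] :> {bseq k of {set V}} /\ A [::].
  move=> /andP[/only_nil s0 As]; split; first exact: val_inj.
  by rewrite -s0.
have [A0|A0] := boolP (A [::]); last first.
  rewrite /run_sum big1 // => s /nilP[_]; by rewrite (negbTE A0).
rewrite /run_sum big_mkcond (bigD1 ([bseq] : {bseq k of {set V}})) //= big1.
  rewrite addr0; case: ifP => // _.
  by rewrite /run_weight big_ord0.
by move=> s sn; case: ifP => // /nilP[s0 _]; rewrite s0 eqxx in sn.
Qed.

Lemma run_sumS k H A : H != set0 ->
  run_sum k.+1 H A = #|H|%:R^-1 *
    \sum_(E in H) run_sum k (delete_edge H E) (fun s => A (E :: s)).
Proof.
move=> H0; rewrite /run_sum big_mkcond
  (big_bseqS k (fun s => if greedy_run H s && A s then run_weight R H s else 0)).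
rewrite {1}/greedy_run remaining0 (negbTE H0) andbF add0r.
rewrite mulr_sumr [RHS]big_mkcond; apply: eq_bigr => E _.
under eq_bigr do rewrite greedy_run_cons run_weight_cons.
case: ifP => EH; last by rewrite big1.
rewrite mulr_sumr [RHS]big_mkcond; apply: eq_bigr => s _.
by case: (greedy_run _ _ && _).
Qed.

Lemma card_delete_edge_lt H E : E \in H -> (#|delete_edge H E| < #|H|)%N.
Proof.
move=> EH; apply: proper_card; apply/properP; split.
  by apply/subsetP=> F; rewrite !inE => /and3P[].
by exists E => //; rewrite !inE eqxx.
Qed.

Lemma run_sum_le_avg k H A (f : {set V} -> R) (c : R) : H != set0 ->
  (forall E, E \in H ->
    run_sum k (delete_edge H E) (fun s => A (E :: s)) <= f E) ->
  \sum_(E in H) f E <= #|H|%:R * c ->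
  run_sum k.+1 H A <= c.
Proof.
move=> H0 hf hc; rewrite run_sumS //.
have H1 : (0 : R) < #|H|%:R by rewrite ltr0n card_gt0.
rewrite mulrC ler_pdivrMr // mulrC; apply: le_trans hc.
exact: ler_sum.
Qed.

Lemma run_sum_le1 k H A : (#|H| <= k)%N -> run_sum k H A <= 1.
Proof.
elim: k H A => [|k IH] H A Hk.
  have -> : H = set0 by apply/eqP; rewrite -cards_eq0 -leqn0.
  by apply: le_trans (run_sum0 _ _) _; case: (A _).
have [->|H0] := eqVneq H set0.
  by apply: le_trans (run_sum0 _ _) _; case: (A _).
apply: (@run_sum_le_avg _ _ _ (fun=> 1)) => // [E EH|].
  by apply: IH; rewrite -ltnS; apply: leq_trans (card_delete_edge_lt EH) Hk.
by rewrite sumr_const mulr1.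
Qed.

Section PessimisticEstimator.
Variables (inv : nat -> {set {set V}} -> {set V} -> Prop).
Variables (bad : nat -> {set {set V}} -> {set V} -> bool).
Variables (pot : nat -> {set {set V}} -> {set V} -> R).

(** The current state is an argument, so that conditioning on the first edge leaves an event of the
    same form. *)
Fixpoint ever_bad i G U s : bool :=
  bad i G U ||
  if s is E :: s' then ever_bad i.+1 (delete_edge G E) (U :\: E) s' else false.

Lemma ever_badP i G U s j : (j <= size s)%N ->
  bad (i + j) (remaining G s j) (foldl (fun U E => U :\: E) U (take j s)) ->
  ever_bad i G U s.
Proof.
elim: s i G U j => [|E s IH] i G U [|j] //=.
- by rewrite addn0 => _ ->.
- by rewrite addn0 => _; rewrite remaining0 => ->.
- by rewrite addnS -addSn ltnS => js hb; rewrite (IH _ _ _ j) ?orbT.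
Qed.

Hypothesis pot_ge0 : forall i G U, 0 <= pot i G U.
Hypothesis pot_bad : forall i G U, inv i G U -> bad i G U -> 1 <= pot i G U.
Hypothesis inv_step : forall i G U E,
  inv i G U -> E \in G -> inv i.+1 (delete_edge G E) (U :\: E).
Hypothesis pot_step : forall i G U, inv i G U -> ~~ bad i G U -> G != set0 ->
  \sum_(E in G) pot i.+1 (delete_edge G E) (U :\: E) <= #|G|%:R * pot i G U.

(** Optional stopping for a nonnegative supermartingale, by induction on a bound for the number of
    edges. The drift condition is imposed at good states only: at a bad state [pot] is at least 1
    and bounds any probability. *)
Lemma greedy_prob_ever_bad i G U :
  inv i G U -> greedy_prob R G (ever_bad i G U) <= pot i G U.
Proof.
suff gen k : (#|G| <= k)%N -> inv i G U ->
    run_sum k G (ever_bad i G U) <= pot i G U by exact: gen.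
elim: k i G U => [|k IH] i G U Gk iG.
  have G0 : G = set0 by apply/eqP; rewrite -cards_eq0 -leqn0.
  rewrite {}G0 in iG *; apply: le_trans (run_sum0 _ _) _; rewrite /= orbF.
  by case: (boolP (bad _ _ _)) => b; [exact: pot_bad | exact: pot_ge0].
have [b|nb] := boolP (bad i G U).
  by apply: le_trans (pot_bad iG b); exact: run_sum_le1.
have [G0|G0] := eqVneq G set0.
  rewrite {}G0 in nb *; apply: le_trans (run_sum0 _ _) _; rewrite /= (negbTE nb).
  exact: pot_ge0.
apply: run_sum_le_avg (pot_step iG nb G0) => // E EG /=.
rewrite (negbTE nb) /=; apply: IH; last exact: inv_step.
by rewrite -ltnS; apply: leq_trans (card_delete_edge_lt EG) Gk.
Qed.

End PessimisticEstimator.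
End GreedyProcess.

(** * Drift inequalities *)

Section RealInequalities.
Variable R : realType.
Implicit Types (x s : R).

(* expR s = expR (- s / 4) ^- 4 <= (1 - s / 4) ^- 4; any constant above 5/8
   can replace 2/3 if the range of s is small enough. *)
Lemma expR_le_quadratic s : `|s| <= 10^-1 -> expR s <= 1 + s + 2 / 3 * s ^+ 2.
Proof.
rewrite ler_norml => /andP[s1 s2].
pose u := s / 4.
have su : s = 4 * u by rewrite /u; field.
have u1 : 0 < 1 - u by rewrite /u; lra.
have hu : (1 - u) ^+ 4 <= expR (- s).
  have -> : - s = (- u) *+ 4 by rewrite -mulr_natl su; ring.
  rewrite -mulr_natl expRM_natl; apply: lerXn2r; rewrite ?nnegrE ?expR_ge0 //; first exact: ltW.
  exact: expR_ge1Dx.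
have ha : 1 <= (1 - u) ^+ 4 * (1 + s + 2 / 3 * s ^+ 2).
  rewrite -subr_ge0; set X := (X in 0 <= X).
  (* After clearing the exponential, the difference is [u ^+ 2] times a quartic with constant term
     2/3, which is positive for [|u| <= 1/40]. *)
  have -> : X = u ^+ 2 * (2/3 - 68/3 * u + 49 * u^+2 - 116/3 * u ^+3 + 32/3 * u^+4).
    by rewrite /X su; field.
  apply: mulr_ge0; first exact: sqr_ge0.
  have b1 : u <= 40^-1 by rewrite /u; lra.
  have b2 : - 40^-1 <= u by rewrite /u; lra.
  have c2 : 0 <= u ^+ 2 by exact: sqr_ge0.
  have c4 : 0 <= u ^+ 4 by rewrite -[4%N]/(2 * 2)%N exprM sqr_ge0.
  have c3 : 0 <= u ^+ 2 * (40^-1 - u) by rewrite mulr_ge0 ?subr_ge0.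
  have e3 : u ^+ 3 = u ^+ 2 * u by ring.
  rewrite e3; nra.
have e1 : expR s * expR (- s) = 1 by rewrite -expRD subrr expR0.
have c : 0 <= 1 + s + 2 / 3 * s ^+ 2.
  have := sqr_ge0 s; lra.
rewrite -(ler_pM2r (expR_gt0 (- s))) e1.
apply: le_trans ha _; rewrite mulrC; exact: ler_wpM2l.
Qed.

Lemma bernoulli_ge (x : R) k : 0 <= x <= 1 -> 1 - k%:R * x <= (1 - x) ^+ k.
Proof.
move=> /andP[x0 x1]; elim: k => [|k IH]; first by rewrite mul0r subr0 expr0.
rewrite exprS; have k0 : 0 <= k%:R * x ^+ 2 :> R by rewrite mulr_ge0 ?sqr_ge0.
apply: (@le_trans _ _ ((1 - x) * (1 - k%:R * x))); last first.
  by apply: ler_wpM2l => //; rewrite subr_ge0.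
by rewrite -natr1; nra.
Qed.

Lemma bernoulli_le (x : R) k :
  0 <= x <= 1 -> (1 - x) ^+ k <= 1 - k%:R * x + (k%:R * x) ^+ 2.
Proof.
move=> /andP[x0 x1]; elim: k => [|k IH]; first by rewrite mul0r expr0; lra.
rewrite exprS.
apply: (@le_trans _ _ ((1 - x) * (1 - k%:R * x + (k%:R * x) ^+ 2))).
  by apply: ler_wpM2l => //; rewrite subr_ge0.
have k0 : 0 <= k%:R :> R by [].
have : 0 <= k%:R * x ^+ 2 by rewrite mulr_ge0 ?sqr_ge0.
have : 0 <= (k%:R * x) ^+ 2 * x by rewrite mulr_ge0 ?sqr_ge0.
have : 0 <= x ^+ 2 by exact: sqr_ge0.
rewrite -natr1; set K := k%:R => *.
rewrite -subr_ge0; set X := (X in 0 <= X).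
have -> : X = K * x ^+ 2 + (K * x) ^+ 2 * x + x ^+ 2 by rewrite /X; ring.
lra.
Qed.

(** With [S2] the sum of squared degrees, Cauchy-Schwarz bounds the expected edge loss from below.
    An excess of [Q] thus yields a self-correction of [15/2 r^3 z Q], which pays for the pair
    correction [r^3 L Q] and for the second-order term of the exponential. *)
Lemma edge_drift_above (r n d a L D Q S2 z : R) :
  2 <= r -> 0 < n -> 0 < d -> d <= D -> 0 <= Q ->
  0 <= z -> a ^+ 2 = z * d -> 6 * r * L <= z ->
  15 / 2 * r * n * z <= Q - n * d / r -> (r * Q) ^+ 2 <= n * S2 ->
  r * d * Q - S2 + r ^+ 3 * L * Q + 2 / 3 * D^-1 * (2 * r * a) ^+ 2 * Q <= 0.
Proof.
move=> r2 n0 d0 dD Q0 z0 az Lz crit cs.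
have r0 : 0 < r by lra.
have D0 : 0 < D by lra.
have h1 : r * d * Q - S2 <= - (15 / 2 * r ^+ 3 * z * Q).
  rewrite -(ler_pM2l n0).
  have := ler_wpM2l (mulr_ge0 (sqr_ge0 r) Q0) crit.
  have -> : r ^+ 2 * Q * (Q - n * d / r) = (r * Q) ^+ 2 - n * (r * d * Q).
    by field; lra.
  nra.
have h2 : D^-1 * a ^+ 2 <= z.
  by rewrite az mulrC ler_pdivrMr //; apply: ler_wpM2l.
have h3 : r ^+ 3 * L * Q <= r ^+ 2 * z * Q / 6.
  have := ler_wpM2l (mulr_ge0 (sqr_ge0 r) Q0) Lz; nra.
have h4 : 2 / 3 * D^-1 * (2 * r * a) ^+ 2 * Q <= 8 / 3 * r ^+ 2 * z * Q.
  have := ler_wpM2l (mulr_ge0 (sqr_ge0 r) Q0) h2; nra.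
have h5 : 2 * (r ^+ 2 * z * Q) <= r ^+ 3 * z * Q.
  have -> : r ^+ 3 * z * Q = r * (r ^+ 2 * z * Q) by ring.
  by apply: ler_wpM2r => //; rewrite !mulr_ge0 // ltW.
have h6 : 0 <= r ^+ 2 * z * Q by rewrite !mulr_ge0 // ltW.
lra.
Qed.

(** Here [S2] has to be bounded from above, so Cauchy-Schwarz is replaced by the fact that all
    degrees are within [a] of [d]. The variance costs [n a^2 = W], against a self-correction of
    [15/2 r^2 W]. *)
Lemma edge_drift_below (r n d a L D Q S2 z : R) :
  2 <= r -> 0 < n -> 0 < d -> d <= D -> 0 <= Q -> 0 <= L ->
  0 <= z -> a ^+ 2 = z * d -> 6 * r * L <= z ->
  15 / 2 * r * n * z <= n * d / r - Q ->
  S2 <= 2 * d * r * Q - n * d ^+ 2 + n * a ^+ 2 ->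
  S2 - r * d * Q + r ^+ 3 * L * Q + 2 / 3 * D^-1 * (2 * r * a) ^+ 2 * Q <= 0.
Proof.
move=> r2 n0 d0 dD Q0 L0 z0 az Lz crit var.
have r0 : 0 < r by lra.
have D0 : 0 < D by lra.
pose W := n * z * d.
have W0 : 0 <= W by rewrite !mulr_ge0 // ltW.
have rQ : r * Q <= n * d.
  have : 0 <= 15 / 2 * r * n * z by rewrite !mulr_ge0 ?invr_ge0 // ltW.
  move=> /le_trans/(_ crit); rewrite subr_ge0 => /(ler_wpM2l (ltW r0)).
  by have -> : r * (n * d / r) = n * d by field; lra.
have h1 : S2 - r * d * Q <= - (15 / 2 * r ^+ 2 * W) + W.
  have := ler_wpM2l (mulr_ge0 (ltW r0) (ltW d0)) crit.
  have -> : r * d * (n * d / r - Q) = n * d ^+ 2 - r * d * Q by field; lra.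
  have : n * a ^+ 2 = W by rewrite az /W; ring.
  rewrite /W; nra.
have h2 : D^-1 * a ^+ 2 <= z.
  by rewrite az mulrC ler_pdivrMr //; apply: ler_wpM2l.
have h3 : r ^+ 3 * L * Q <= r / 6 * W.
  have := ler_wpM2l (mulr_ge0 (sqr_ge0 r) L0) rQ.
  have := ler_wpM2l (mulr_ge0 (ltW r0) (mulr_ge0 (ltW n0) (ltW d0))) Lz.
  rewrite /W; nra.
have h4 : 2 / 3 * D^-1 * (2 * r * a) ^+ 2 * Q <= 8 / 3 * r * W.
  have := ler_wpM2l (mulr_ge0 (sqr_ge0 r) Q0) h2.
  have := ler_wpM2l (mulr_ge0 (ltW r0) z0) rQ.
  rewrite /W; nra.
have h5 : 2 * (r * W) <= r ^+ 2 * W.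
  have -> : r ^+ 2 * W = r * (r * W) by ring.
  by apply: ler_wpM2r => //; rewrite mulr_ge0 // ltW.
have h6 : 2 * W <= r * W by exact: ler_wpM2r.
lra.
Qed.

(** The second-order term of the degree exponential: its leading part [(r - 1) A d / 2] uses up
    about half of the error growth [r A d]. *)
Lemma variance_term_le (r d a A D S dv : R) :
  2 <= r -> 0 < d -> d <= D -> 0 < A -> A <= a -> a <= d / 10 -> 0 <= S ->
  S <= dv * ((r - 1) * (d + a)) -> dv <= d + a ->
  A / (2 * D) * S <= (r - 1) * A / 2 * d + 3 / 2 * (r * a ^+ 2).
Proof.
move=> r2 d0 dD A0 Aa ad S0 Su dvu.
have a0 : 0 < a by lra.
have D0 : 0 < D by lra.
have S1 : S <= (r - 1) * (d + a) ^+ 2.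
  apply: le_trans Su _; have h : 0 <= (r - 1) * (d + a) by apply: mulr_ge0; lra.
  have -> : (r - 1) * (d + a) ^+ 2 = (d + a) * ((r - 1) * (d + a)) by ring.
  exact: ler_wpM2r.
have S2 : S <= (r - 1) * (d * (d + 3 * a)).
  apply: le_trans S1 _; apply: ler_wpM2l; first lra.
  have : a ^+ 2 <= a * d by rewrite expr2; apply: ler_wpM2l; lra.
  nra.
have AS : A / (2 * D) * S <= A / (2 * d) * S.
  apply: ler_wpM2r => //; apply: ler_wpM2l; first exact: ltW.
  by rewrite lef_pV2 ?posrE; lra.
apply: le_trans AS _.
apply: (@le_trans _ _ (A / (2 * d) * ((r - 1) * (d * (d + 3 * a))))).
  by apply: ler_wpM2l => //; rewrite divr_ge0 //; lra.
have -> : A / (2 * d) * ((r - 1) * (d * (d + 3 * a)))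
    = (r - 1) * A / 2 * d + 3 / 2 * ((r - 1) * (A * a)) by field; lra.
have AaP : A * a <= a ^+ 2 by rewrite expr2; apply: ler_wpM2r; lra.
rewrite lerD2l; apply: ler_wpM2l; first lra.
apply: (@le_trans _ _ ((r - 1) * a ^+ 2)); first by apply: ler_wpM2l; lra.
by apply: ler_wpM2r; [exact: sqr_ge0 | lra].
Qed.

(** The bound [e_d] grows by [r^2 A / n] per step, which is [r A w] after scaling by [#|G|]. As [w]
    is close to [d], this is [r A d] up to terms of order [a^2]. *)
Lemma error_growth_ge (r d a A w : R) :
  2 <= r -> 0 < d -> 0 < A -> A <= a -> a <= d / 10 ->
  d ^+ 2 - 15 * r ^+ 2 * a ^+ 2 <= w * d ->
  r * A * d - 15 * r ^+ 2 * a ^+ 2 * r / 10 <= r * A * w.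
Proof.
move=> r2 d0 A0 Aa ad wl.
have h : (r * A) * (d ^+ 2 - 15 * r ^+ 2 * a ^+ 2) <= (r * A) * (w * d).
  by apply: ler_wpM2l => //; apply: mulr_ge0; lra.
have h2 : r * A * (15 * r ^+ 2 * a ^+ 2) <= 15 * r ^+ 2 * a ^+ 2 * r / 10 * d.
  have -> : r * A * (15 * r ^+ 2 * a ^+ 2) = 15 * r ^+ 2 * a ^+ 2 * r * A by ring.
  have -> : 15 * r ^+ 2 * a ^+ 2 * r / 10 * d
    = 15 * r ^+ 2 * a ^+ 2 * r * (d / 10) by field.
  by apply: ler_wpM2l; [rewrite !mulr_ge0 ?sqr_ge0 //; lra | lra].
rewrite -(ler_pM2r d0).
have -> : r * A * w * d = r * A * (w * d) by ring.
have -> : (r * A * d - 15 * r ^+ 2 * a ^+ 2 * r / 10) * d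
  = r * A * d ^+ 2 - 15 * r ^+ 2 * a ^+ 2 * r / 10 * d by ring.
lra.
Qed.

(* In the two lemmas below w is the average degree r Q / n and tau is the
   decrement of the degree trajectory divided by r / n. *)
Lemma degree_drift_above (r d a A L D w S dv tau : R) :
  2 <= r -> 0 < d -> d <= D -> 0 < A -> A <= a -> a <= d / 10 ->
  100 * r ^+ 3 * a ^+ 2 <= A * d ->
  0 <= L -> 6 * r * L * d <= a ^+ 2 ->
  w * d <= d ^+ 2 + 15 * r ^+ 2 * a ^+ 2 ->
  d ^+ 2 - 15 * r ^+ 2 * a ^+ 2 <= w * d ->
  0 <= dv -> 0 <= S -> S <= dv * ((r - 1) * (d + a)) ->
  dv * ((r - 1) * (d - a)) <= S + dv * (r ^+ 2 * L) ->
  d + a - A / 2 <= dv -> dv <= d + a -> tau <= (r - 1) * d ->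
  tau * w - S + A / (2 * D) * S - r * A * w <= 0.
Proof.
move=> r2 d0 dD A0 Aa ad ad2 L0 Ld wu wl dv0 S0 Su.
have a0 : 0 < a by lra.
have P0 : 0 <= a ^+ 2 by exact: sqr_ge0.
have rP : 2 * a ^+ 2 <= r * a ^+ 2 by apply: ler_wpM2r.
have r2P : 2 * (r * a ^+ 2) <= r ^+ 2 * a ^+ 2.
  by rewrite expr2 -mulrA; apply: ler_wpM2r => //; lra.
have r3P : 2 * (r ^+ 2 * a ^+ 2) <= r ^+ 3 * a ^+ 2.
  by rewrite [r ^+ 3]exprS -mulrA; apply: ler_wpM2r => //; lra.
set P := a ^+ 2 in ad2 Ld wu wl P0 rP r2P r3P.
have AaP : A * a <= P by rewrite /P expr2; apply: ler_wpM2r; lra.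
have Pad : P <= a * (d / 10) by rewrite /P expr2; apply: ler_wpM2l; lra.
have rP15 : 15 * r ^+ 2 * P <= A * d / 10 by lra.
have Add : A * d <= d * d by apply: ler_wpM2r; lra.
move=> Sl dvl dvu hm.
have r1 : 1 <= r by lra.
have w0 : 0 <= w.
  rewrite -(pmulr_lge0 _ d0); apply: le_trans wl.
  by rewrite expr2; lra.
have h1 : tau * w <= (r - 1) * d ^+ 2 + 15 * (r ^+ 3 * P).
  apply: (@le_trans _ _ ((r - 1) * d * w)); first exact: ler_wpM2r.
  have := ler_wpM2l (_ : 0 <= r - 1) wu; rewrite subr_ge0 => /(_ r1).
  move=> h; have : 0 <= r ^+ 2 * P by rewrite mulr_ge0 ?sqr_ge0.
  nra.
have La : L <= a / 10.
  have : 12 * L * d <= P.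
    apply: le_trans Ld; rewrite -mulrA -[6 * r * L * d]mulrA.
    by apply: ler_wpM2r; [rewrite mulr_ge0 // ltW | lra].
  by move=> /le_trans/(_ Pad) h3; rewrite -(ler_pM2r d0); lra.
have dd2 : dv <= 2 * d by lra.
have h2 : dv * (r ^+ 2 * L) <= r * P / 2.
  apply: (@le_trans _ _ (2 * d * (r ^+ 2 * L))).
    by apply: ler_wpM2r => //; rewrite mulr_ge0 ?sqr_ge0.
  have := ler_wpM2l (_ : 0 <= r) Ld => /(_ (ltac:(lra))); nra.
(* The neighbours of [v] may all have degree [d - a], but the excess [a] of [dv] compensates for
   that. Only the window width [A / 2] is lost at first order. *)
have h3 : (r - 1) * (d ^+ 2 - P - A / 2 * d) <= dv * ((r - 1) * (d - a)).
  have h : 0 <= (r - 1) * (d - a) by apply: mulr_ge0; lra.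
  apply: le_trans (ler_wpM2r h dvl).
  have -> : (d + a - A / 2) * ((r - 1) * (d - a))
     = (r - 1) * (d ^+ 2 - P - A / 2 * d + A * a / 2) by rewrite /P; ring.
  apply: ler_wpM2l; first lra.
  have : 0 <= A * a by apply: mulr_ge0; lra.
  lra.
have h4 := variance_term_le r2 d0 dD A0 Aa ad S0 Su dvu.
have h5 := error_growth_ge r2 d0 A0 Aa ad wl.
rewrite -/P in h4 h5.
have h6 : (r - 1) * P <= r * P by apply: ler_wpM2r; lra.
(* Budget: the window and the second-order term cost [(r - 1) A d / 2] each, while the error growth
   supplies [r A d]. The surplus [A d >= 100 r^3 a^2] absorbs all terms of order [a^2]. *)
nra.
Qed.

Lemma degree_drift_below (r d a A L D w S dv tau : R) :
  2 <= r -> 0 < d -> d <= D -> 0 < A -> A <= a -> a <= d / 10 ->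
  100 * r ^+ 3 * a ^+ 2 <= A * d ->
  0 <= L -> 6 * r * L * d <= a ^+ 2 ->
  w * d <= d ^+ 2 + 15 * r ^+ 2 * a ^+ 2 ->
  d ^+ 2 - 15 * r ^+ 2 * a ^+ 2 <= w * d ->
  0 <= dv -> 0 <= S -> S <= dv * ((r - 1) * (d + a)) ->
  dv <= d - a + A / 2 -> (r - 1) * d - r ^+ 3 * L <= tau -> tau <= (r - 1) * d ->
  S - tau * w + A / (2 * D) * S - r * A * w <= 0.
Proof.
move=> r2 d0 dD A0 Aa ad ad2 L0 Ld wu wl dv0 S0 Su.
have a0 : 0 < a by lra.
have P0 : 0 <= a ^+ 2 by exact: sqr_ge0.
have rP : 2 * a ^+ 2 <= r * a ^+ 2 by apply: ler_wpM2r.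
have r2P : 2 * (r * a ^+ 2) <= r ^+ 2 * a ^+ 2.
  by rewrite expr2 -mulrA; apply: ler_wpM2r => //; lra.
have r3P : 2 * (r ^+ 2 * a ^+ 2) <= r ^+ 3 * a ^+ 2.
  by rewrite [r ^+ 3]exprS -mulrA; apply: ler_wpM2r => //; lra.
set P := a ^+ 2 in ad2 Ld wu wl P0 rP r2P r3P.
have AaP : A * a <= P by rewrite /P expr2; apply: ler_wpM2r; lra.
have Pad : P <= a * (d / 10) by rewrite /P expr2; apply: ler_wpM2l; lra.
have rP15 : 15 * r ^+ 2 * P <= A * d / 10 by lra.
have Add : A * d <= d * d by apply: ler_wpM2r; lra.
move=> dvu hm hm2.
have r1 : 1 <= r by lra.
have w0 : 0 <= w.
  rewrite -(pmulr_lge0 _ d0); apply: le_trans wl.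
  by rewrite expr2; lra.
have w2 : w <= 2 * d.
  rewrite -(ler_pM2r d0); apply: le_trans wu _.
  by rewrite expr2; lra.
have h1 : (r - 1) * d ^+ 2 - 15 * (r ^+ 3 * P) - r ^+ 2 * P / 2 <= tau * w.
  apply: (@le_trans _ _ (((r - 1) * d - r ^+ 3 * L) * w)); last exact: ler_wpM2r.
  have h : r ^+ 3 * L * w <= r ^+ 2 * P / 2.
    apply: (@le_trans _ _ (r ^+ 3 * L * (2 * d))).
      by apply: ler_wpM2l => //; rewrite mulr_ge0 // exprn_ge0 //; lra.
    have := ler_wpM2l (sqr_ge0 r) Ld; nra.
  have := ler_wpM2l (_ : 0 <= r - 1) wl; rewrite subr_ge0 => /(_ r1).
  move=> h'; have : 0 <= r ^+ 2 * P by rewrite mulr_ge0 ?sqr_ge0.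
  nra.
(* Mirror image of the upper case: the deficit [a] of [dv] offsets neighbours of degree up to
   [d + a], again at first-order cost [(r - 1) A d / 2]. *)
have h3 : S <= (r - 1) * (d ^+ 2 + A / 2 * d) + r * P / 2.
  have h : 0 <= (r - 1) * (d + a) by apply: mulr_ge0; lra.
  apply: le_trans Su _; apply: le_trans (ler_wpM2r h dvu) _.
  have -> : (d - a + A / 2) * ((r - 1) * (d + a))
     = (r - 1) * (d ^+ 2 + A / 2 * d) + (r - 1) * (A * a / 2 - P).
    by rewrite /P; ring.
  rewrite lerD2l.
  apply: (@le_trans _ _ 0).
    by apply: mulr_ge0_le0; lra.
  lra.
have h4 : A / (2 * D) * S <= (r - 1) * A / 2 * d + 3 / 2 * (r * P).
  by apply: (variance_term_le r2 d0 dD A0 Aa ad S0 Su); lra.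
have h5 := error_growth_ge r2 d0 A0 Aa ad wl.
rewrite -/P in h5.
nra.
Qed.

End RealInequalities.

(** * One step of the process *)

Section OneStep.
Variable R : realType.

(* At step i: n = N p unsaturated vertices, nominal degree d = D p^(r - 1),
   degree error a = e_d, with A = (6 r L D log N)^(1/2) and l = log N. *)
Record regime (r n d a A L D l : R) : Prop := Regime {
  reg_r : 2 <= r;
  reg_n : 0 < n;
  reg_d : 0 < d;
  reg_dD : d <= D;
  reg_A : 0 < A;
  reg_Aa : A <= a;
  reg_a : 100 * r ^+ 3 * a ^+ 2 <= A * d;
  reg_L : 0 < L;
  reg_l : 1 <= l;
  reg_A2 : A ^+ 2 = 6 * r * L * D * l;
  reg_dLn : d <= L * n }.

Lemma regime_small (r n d a A L D l : R) : regime r n d a A L D l ->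
  [/\ 100 * r ^+ 3 * a <= d, a <= d / 10, 40 * r * a <= d,
      6 * r * L * d <= a ^+ 2 & r ^+ 3 * L <= r * a].
Proof.
case=> r2 n0 d0 dD A0 Aa a2 L0 l1 A2 dLn.
have a0 : 0 < a by lra.
have r0 : 0 < r by lra.
have h1 : 100 * r ^+ 3 * a <= d.
  rewrite -(ler_pM2r a0); have : A * d <= d * a by rewrite mulrC ler_pM2l.
  have -> : 100 * r ^+ 3 * a * a = 100 * r ^+ 3 * a ^+ 2 by ring.
  lra.
have r3 : 4 * r <= r ^+ 3.
  have -> : r ^+ 3 = (r * r) * r by ring.
  apply: ler_wpM2r; first exact: ltW.
  have -> : 4 = 2 * 2 :> R by ring.
  by rewrite ler_pM.
have h3 : 40 * r * a <= d.
  apply: le_trans h1; apply: ler_wpM2r; first exact: ltW.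
  lra.
have h2 : a <= d / 10.
  have : 2 * a <= r * a by apply: ler_wpM2r; first exact: ltW.
  lra.
have h4 : 6 * r * L * d <= a ^+ 2.
  apply: (@le_trans _ _ (A ^+ 2)); last first.
    by apply: lerXn2r; rewrite ?nnegrE // ltW.
  rewrite A2; have h0 : 0 <= 6 * r * L by rewrite !mulr_ge0 // ltW.
  apply: (@le_trans _ _ (6 * r * L * D)); first exact: ler_wpM2l.
  rewrite -[leLHS]mulr1; apply: ler_wpM2l => //.
  by apply: mulr_ge0 => //; lra.
split=> //.
have h5 : 6 * r * L <= a / 10.
  rewrite -(ler_pM2r d0); apply: le_trans h4 _.
  have -> : a / 10 * d = a * (d / 10) by field.
  by rewrite expr2; apply: ler_wpM2l; lra.
have h6 : 600 * r ^+ 4 * L <= a.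
  rewrite -(ler_pM2r d0).
  apply: (@le_trans _ _ (100 * r ^+ 3 * a ^+ 2)).
    have -> : 600 * r ^+ 4 * L * d = 100 * r ^+ 3 * (6 * r * L * d) by ring.
    by apply: ler_wpM2l => //; rewrite mulr_ge0 // exprn_ge0 // ltW.
  by apply: le_trans a2 _; apply: ler_wpM2r => //; exact: ltW.
have -> : r ^+ 3 * L = r ^+ 3 * (L * 1) by ring.
apply: (@le_trans _ _ (600 * r ^+ 4 * L)).
  rewrite mulr1; apply: ler_wpM2r; first exact: ltW.
  have -> : 600 * r ^+ 4 = r ^+ 3 * (600 * r) by ring.
  rewrite -[leLHS]mulr1; apply: ler_wpM2l; last lra.
  by rewrite exprn_ge0 // ltW.
apply: le_trans h6 _.
by rewrite -[leLHS]mul1r; apply: ler_wpM2r; lra.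
Qed.

(** Since [n / d >= 1 / L], replacing [a] by [A] and expanding [A^2 = 6 r L D l] gives the bound. It
    makes an edge exponential at most [N^(-9/4)] when the deviation is below half its error
    bound. *)
Lemma regime_edge_gain (r n d a A L D l : R) : regime r n d a A L D l ->
  9 / 4 * l <= D^-1 * (15 * r * n * (a ^+ 2 / d) / 2).
Proof.
case=> r2 n0 d0 dD A0 Aa _ L0 l1 A2 dLn.
have r0 : 0 < r by lra.
have a0 : 0 < a by lra.
have D0 : 0 < D by lra.
rewrite [leRHS]mulrC ler_pdivlMr //.
have -> : 15 * r * n * (a ^+ 2 / d) / 2 = 15 / 2 * r * (n / d) * a ^+ 2.
  by field; rewrite gt_eqF.
have nd : 1 <= L * (n / d) by rewrite mulrA ler_pdivlMr // mul1r.
have nd0 : 0 <= n / d by rewrite divr_ge0 // ltW.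
apply: (@le_trans _ _ (15 / 2 * r * (n / d) * A ^+ 2)); last first.
  apply: ler_wpM2l; first by rewrite !mulr_ge0 ?invr_ge0 // ltW.
  by apply: lerXn2r; rewrite ?nnegrE // ltW.
rewrite A2.
have -> : 15 / 2 * r * (n / d) * (6 * r * L * D * l)
  = (45 * (r ^+ 2 * (L * (n / d)))) * (l * D) by field; rewrite gt_eqF.
rewrite -(mulrA _ l D); apply: ler_wpM2r; first by rewrite mulr_ge0 //; lra.
have r21 : 1 <= r ^+ 2 by rewrite expr_ge1 //; lra.
have := ler_pM ler01 ler01 r21 nd; lra.
Qed.

Lemma sum_expR_le (T : finType) (G : {set T}) (y : T -> R) (c B : R) :
  (forall E, E \in G -> `|c * y E| <= 10^-1) ->
  (forall E, E \in G -> `|y E| <= B) ->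
  \sum_(E in G) expR (c * y E)
    <= #|G|%:R + c * \sum_(E in G) y E + 2 / 3 * c ^+ 2 * B ^+ 2 * #|G|%:R.
Proof.
move=> hc hB; rewrite mulr_sumr.
have -> : #|G|%:R = \sum_(E in G) (1 : R) by rewrite sumr_const.
rewrite [in X in _ <= _ + X]mulr_sumr -!big_split /=.
apply: ler_sum => E EG; apply: le_trans (expR_le_quadratic (hc E EG)) _.
rewrite lerD2l mulr1 exprMn mulrA; apply: ler_wpM2l.
  by rewrite mulr_ge0 ?sqr_ge0 // divr_ge0.
rewrite -real_normK ?num_real //; apply: lerXn2r (hB E EG); rewrite nnegrE //.
exact: le_trans (hB E EG).
Qed.

(** Cauchy-Schwarz against a constant, read off from the nonnegative sum of [(n f u - S)^2]. *)
Lemma sum_sqr_ge (T : finType) (U : {set T}) (f : T -> R) :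
  (\sum_(u in U) f u) ^+ 2 <= #|U|%:R * \sum_(u in U) f u ^+ 2.
Proof.
have [->|U0] := eqVneq U set0.
  by rewrite !big_set0 cards0 mul0r expr2 mul0r.
set n : R := #|U|%:R; set S := \sum_(u in U) f u.
have n0 : 0 < n by rewrite ltr0n card_gt0.
have : 0 <= \sum_(u in U) (n * f u - S) ^+ 2 by apply: sumr_ge0 => *; exact: sqr_ge0.
rewrite (eq_bigr (fun u => n ^+ 2 * f u ^+ 2 - 2 * n * S * f u + S ^+ 2)); last first.
  by move=> u _; ring.
rewrite big_split /= sumr_const sumrB -!mulr_sumr -/S -mulr_natl -/n => h.
rewrite -(ler_pM2l n0) -subr_ge0; apply: le_trans h _.
by rewrite le_eqVlt; apply/orP; left; apply/eqP; ring.
Qed.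

Lemma sum_sqr_le (T : finType) (U : {set T}) (f : T -> R) (d a : R) :
  (forall u, u \in U -> `|f u - d| <= a) ->
  \sum_(u in U) f u ^+ 2
    <= 2 * d * \sum_(u in U) f u - #|U|%:R * d ^+ 2 + #|U|%:R * a ^+ 2.
Proof.
move=> h.
have -> : #|U|%:R = \sum_(E in U) (1 : R) by rewrite sumr_const.
rewrite mulr_sumr !mulr_suml -sumrB -big_split /=.
apply: ler_sum => u uU; rewrite !mul1r -subr_ge0.
have -> : 2 * d * f u - d ^+ 2 + a ^+ 2 - f u ^+ 2 = a ^+ 2 - (f u - d) ^+ 2 by ring.
rewrite subr_ge0 -[X in X <= _]real_normK ?num_real //.
by apply: lerXn2r (h u uU); rewrite nnegrE // (le_trans _ (h u uU)).
Qed.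

Variable V : finType.
Implicit Types (G : {set {set V}}) (U E F : {set V}) (u v w : V).

(** The sign [sg] selects the tail. If the signed deviation is at least [e / 2], the drift lemmas
    make the exponential a supermartingale; otherwise a single step moves the exponent by too little
    to pass [1 - 9/4 l]. *)
Lemma edge_step (r Lc : nat) G U (d a A D l q' eq' sg : R) :
  uniform r G -> (forall F, F \in G -> F \subset U) ->
  (forall u w, u != w -> (pair_degree G u w <= Lc)%N) ->
  regime r%:R #|U|%:R d a A Lc%:R D l ->
  (forall v, v \in U -> `|(degree G v)%:R - d| <= a) ->
  let q := #|U|%:R * d / r%:R in
  let e := 15 * r%:R * #|U|%:R * (a ^+ 2 / d) in
  r%:R * d - r%:R ^+ 3 * Lc%:R <= q - q' -> q - q' <= r%:R * d -> e <= eq' ->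
  (sg == 1) || (sg == -1) ->
  \sum_(E in G) expR (D^-1 * (sg * (#|delete_edge G E|%:R - q') - eq'))
    <= #|G|%:R * (expR (D^-1 * (sg * (#|G|%:R - q) - e)) + expR (1 - 9 / 4 * l)).
Proof.
move=> ur GU hL reg dev q e tl tu ee sg1.
have [h100 h10 h40 hL6 hL3] := regime_small reg.
have [r2 n0 d0 dD A0 Aa a2 L0 l1 A2 dLn] := reg.
set rR : R := r%:R in r2 *; set n : R := #|U|%:R in n0 *.
set L : R := Lc%:R in L0 *.
set Q : R := #|G|%:R.
have r0 : 0 < rR by lra.
have D0 : 0 < D by lra.
have a0 : 0 < a by lra.
have rn0 : (0 < r)%N by rewrite -(ltr0n R).
(* [y E] bounds the change of the signed deviation. The summand [r^3 L] covers the overcount of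
   edges meeting [E] when [sg = 1] and the curvature of the trajectory when [sg = -1]; since it is
   at most [r a], [y E] is of order [r a]. *)
pose y E := sg * (rR * d - \sum_(v in E) (degree G v)%:R) + rR ^+ 3 * L.
have G0 E : E \in G -> E != set0 by move=> EG; rewrite -card_gt0 (ur E EG).
have rL : rR ^+ 2 * L <= rR ^+ 3 * L.
  rewrite [rR ^+ 3]exprS -mulrA -[leLHS]mul1r; apply: ler_wpM2r; last lra.
  by rewrite mulr_ge0 ?sqr_ge0 // ltW.
have step E : E \in G ->
    sg * (#|delete_edge G E|%:R - q') - eq' <= sg * (Q - q) - e + y E.
  move=> EG.
  have hE := card_delete_edge G (G0 E EG).
  have hR : #|delete_edge G E|%:R + #|hitting G E|%:R = Q by rewrite -natrD hE.
  have h1 : #|hitting G E|%:R <= \sum_(v in E) (degree G v)%:R :> R.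
    by rewrite -natr_sum ler_nat hitting_le.
  have h2 : \sum_(v in E) (degree G v)%:R <= #|hitting G E|%:R + rR ^+ 2 * L.
    rewrite -natr_sum -natrX -natrM -natrD ler_nat.
    apply: leq_trans (hitting_ge E hL) _; rewrite (ur E EG) leq_add2l leq_mul2r.
    by apply/orP; right; rewrite -mulnn leq_mul2l leq_pred orbT.
  rewrite /y; case/orP: sg1 => /eqP ->; lra.
have sumE E : E \in G ->
    `|rR * d - \sum_(v in E) (degree G v)%:R| <= rR * a.
  move=> EG.
  have -> : rR * d = \sum_(v in E) d by rewrite sumr_const (ur E EG) -mulr_natl.
  have -> : rR * a = \sum_(v in E) a by rewrite sumr_const (ur E EG) -mulr_natl.
  rewrite -sumrB; apply: le_trans (ler_norm_sum _ _ _) _.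
  apply: ler_sum => v vE; rewrite distrC; apply: dev.
  exact: (subsetP (GU E EG)).
have yB E : E \in G -> `|y E| <= 2 * rR * a.
  move=> EG; have := sumE E EG; rewrite /y !ler_norml => /andP[s1 s2].
  have ? : 0 <= rR ^+ 3 * L by rewrite mulr_ge0 ?exprn_ge0 // ltW.
  by case/orP: sg1 => /eqP ->; lra.
have Dv0 : 0 < D^-1 by rewrite invr_gt0.
have yB10 E : E \in G -> `|D^-1 * y E| <= 10^-1.
  move=> EG; rewrite normrM (gtr0_norm Dv0) mulrC ler_pdivrMr //.
  by apply: le_trans (yB E EG) _; lra.
have [crit|ncrit] := lerP (e / 2) (sg * (Q - q)).
  rewrite mulrDr; apply: (@le_trans _ _ (Q * expR (D^-1 * (sg * (Q - q) - e)))); last first.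
    by rewrite lerDl mulr_ge0 ?expR_ge0 // ler0n.
  apply: (@le_trans _ _ (\sum_(E in G)
      (expR (D^-1 * (sg * (Q - q) - e)) * expR (D^-1 * y E)))).
    apply: ler_sum => E EG; rewrite -expRD ler_expR -mulrDr.
    by apply: ler_wpM2l; [exact: ltW | exact: step].
  rewrite -mulr_sumr mulrC; apply: ler_wpM2r; first exact: expR_ge0.
  apply: le_trans (sum_expR_le yB10 yB) _; rewrite -/Q.
  pose S2 := \sum_(u in U) (degree G u)%:R ^+ 2 : R.
  have sumy : \sum_(E in G) y E = sg * (rR * d * Q - S2) + rR ^+ 3 * L * Q.
    rewrite /y big_split /= sumr_const -mulr_sumr sumrB sumr_const.
    rewrite -[in LHS](mulr_natr (rR * d)) -[in LHS](mulr_natr (_ * L)) -/Q.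
    congr (sg * (_ - _) + _); rewrite /S2.
    under eq_bigr do rewrite -natr_sum.
    rewrite -natr_sum (sum_edge_degrees GU) natr_sum.
    by apply: eq_bigr => u _; rewrite natrX.
  have sumd : \sum_(u in U) (degree G u)%:R = rR * Q.
    by rewrite -natr_sum (sum_degree_uniform ur GU) natrM.
  have cs : (rR * Q) ^+ 2 <= n * S2 by rewrite -sumd; exact: sum_sqr_ge.
  have var : S2 <= 2 * d * rR * Q - n * d ^+ 2 + n * a ^+ 2.
    rewrite -(mulrA _ rR) -sumd; exact: sum_sqr_le.
  pose z := a ^+ 2 / d.
  have z0 : 0 <= z by rewrite divr_ge0 ?sqr_ge0 // ltW.
  have az : a ^+ 2 = z * d by rewrite /z; field; lra.
  have Lz : 6 * rR * L <= z by rewrite /z ler_pdivlMr.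
  have Q0 : 0 <= Q by rewrite ler0n.
  have e2 : e / 2 = 15 / 2 * rR * n * z by rewrite /e /z -/n; field; lra.
  rewrite -[leRHS]addr0 -addrA lerD2l.
  suff : sg * (rR * d * Q - S2) + rR ^+ 3 * L * Q +
      2 / 3 * D^-1 * (2 * rR * a) ^+ 2 * Q <= 0.
    rewrite -(pmulr_rle0 _ Dv0); apply: le_trans.
    rewrite sumy le_eqVlt; apply/orP; left; apply/eqP; field; lra.
  rewrite e2 in crit; case/orP: sg1 => /eqP sgE; rewrite sgE in crit *.
    rewrite mul1r; apply: (edge_drift_above r2 n0 d0 dD Q0 z0 az Lz) => //.
    by move: crit; rewrite mul1r.
  rewrite mulN1r opprB.
  apply: (edge_drift_below r2 n0 d0 dD Q0 (ltW L0) z0 az Lz _ var).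
  by move: crit; rewrite mulN1r opprB.
apply: (@le_trans _ _ (Q * expR (1 - 9 / 4 * l))); last first.
  by apply: ler_wpM2l; rewrite ?ler0n // lerDr expR_ge0.
rewrite /Q mulr_natl -sumr_const; apply: ler_sum => E EG; rewrite ler_expR.
have le_e : 9 / 4 * l <= D^-1 * (e / 2) by exact: regime_edge_gain reg.
apply: (@le_trans _ _ (D^-1 * (- (e / 2)) + D^-1 * y E)).
  rewrite -mulrDr; apply: ler_wpM2l; first exact: ltW.
  by apply: le_trans (step E EG) _; lra.
rewrite addrC mulrN; apply: lerB => //.
by have := yB10 E EG; rewrite ler_norml => /andP[_]; lra.
Qed.

End OneStep.

(** * One step for the vertex degrees *)

Section DegreeStep.
Variables (R : realType) (V : finType).
Implicit Types (G : {set {set V}}) (U E F : {set V}) (u v w : V).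

Lemma sum_hitting_pairs_bounds (r Lc : nat) G U v (d a : R) :
  (0 < r)%N -> uniform r G -> (forall F, F \in G -> F \subset U) ->
  (forall u w, u != w -> (pair_degree G u w <= Lc)%N) ->
  (forall v, v \in U -> `|(degree G v)%:R - d| <= a) ->
  let S := \sum_(E in G | v \notin E)
    #|[set F in hitting G E | v \in F]|%:R : R in
  S <= (degree G v)%:R * ((r%:R - 1) * (d + a)) /\
  (degree G v)%:R * ((r%:R - 1) * (d - a))
    <= S + (degree G v)%:R * (r%:R ^+ 2 * Lc%:R).
Proof.
move=> r0 ur GU hL dev S.
have r1 : r.-1%:R = r%:R - 1 :> R by rewrite -[in RHS](prednK r0) -natr1 addrK.
have SE : S = (\sum_(E in G | v \notin E) #|[set F in hitting G E | v \in F]|)%N%:R.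
  by rewrite natr_sum.
have cst (b : R) : \sum_(F in G | v \in F) \sum_(u in F :\ v) b
    = (degree G v)%:R * ((r%:R - 1) * b).
  rewrite (eq_bigr (fun=> (r%:R - 1) * b)) => [|F /andP[FG vF]].
    rewrite sumr_const mulr_natl /degree; congr (_ *+ _).
    by apply: eq_card => F; rewrite !inE.
  rewrite sumr_const -[LHS]mulr_natl; congr (_ * _).
  by rewrite -r1 -(ur F FG) (cardsD1 v F) vF.
split.
  rewrite SE; apply: (@le_trans _ _
    (\sum_(F in G | v \in F) \sum_(u in F :\ v) degree G u)%N%:R).
    by rewrite ler_nat; exact: sum_hitting_pairs_le.
  rewrite -cst natr_sum; apply: ler_sum => F /andP[FG vF].
  rewrite natr_sum; apply: ler_sum => u; rewrite !inE => /andP[_ uF].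
  by have := dev u (subsetP (GU F FG) u uF); rewrite ler_norml => /andP[_]; lra.
apply: (@le_trans _ _
    (\sum_(F in G | v \in F) \sum_(u in F :\ v) degree G u)%N%:R).
  rewrite -cst natr_sum; apply: ler_sum => F /andP[FG vF].
  rewrite natr_sum; apply: ler_sum => u; rewrite !inE => /andP[_ uF].
  by have := dev u (subsetP (GU F FG) u uF); rewrite ler_norml => /andP[+ _]; lra.
rewrite SE -natrX -!natrM -natrD ler_nat.
exact: sum_hitting_pairs_ge.
Qed.

(** Here [x i] is the degree loss. Since [0 <= x i <= b], the square in the exponential estimate is
    at most [b (x i)], so the second-order term is controlled by the mean loss. The average is then
    put back into one exponential by [1 + y <= exp y]. *)
Lemma sum_expR_removed_le (I : finType) (P : pred I) (x : I -> R)
    (c theta sg b : R) (Q : nat) :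
  (#|P| <= Q)%N -> (0 < Q)%N -> 0 <= theta -> theta * b <= 10^-1 ->
  (sg == 1) || (sg == -1) ->
  (forall i, P i -> 0 <= x i <= b) ->
  c + (- sg + 2 / 3 * theta * b) * (\sum_(i | P i) x i) / Q%:R <= 0 ->
  \sum_(i | P i) expR (theta * (c - sg * x i)) <= Q%:R.
Proof.
move=> PQ Q0 th0 tb sg1 hx hc.
have Q1 : 0 < Q%:R :> R by rewrite ltr0n.
apply: (@le_trans _ _ (\sum_(i | P i)
    expR (theta * c) * (1 + theta * (- sg + 2 / 3 * theta * b) * x i))).
  apply: ler_sum => i Pi; rewrite mulrBr expRD; apply: ler_wpM2l.
    exact: expR_ge0.
  have /andP[x0 xb] := hx i Pi.
  have tx : theta * x i <= 10^-1 by apply: le_trans tb; exact: ler_wpM2l.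
  have tx0 : 0 <= theta * x i by exact: mulr_ge0.
  have sgx : `|- (theta * (sg * x i))| <= 10^-1.
    by rewrite normrN mulrCA; case/orP: sg1 => /eqP ->;
      rewrite ?mul1r ?mulN1r ?normrN ger0_norm.
  apply: le_trans (expR_le_quadratic sgx) _.
  have sg2 : sg ^+ 2 = 1 by case/orP: sg1 => /eqP ->; ring.
  have -> : (- (theta * (sg * x i))) ^+ 2 = theta ^+ 2 * x i * x i.
    by rewrite -[RHS]mul1r -sg2; ring.
  have : theta ^+ 2 * x i * x i <= theta ^+ 2 * x i * b.
    by apply: ler_wpM2l => //; rewrite mulr_ge0 ?sqr_ge0.
  lra.
rewrite -mulr_sumr big_split /= -mulr_sumr.
set S := \sum_(i | P i) x i in hc *.
set k := - sg + 2 / 3 * theta * b in hc *.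
have PQ' : \sum_(i | P i) (1 : R) <= Q%:R by rewrite sumr_const ler_nat.
apply: (@le_trans _ _ (expR (theta * c) * (Q%:R * expR (theta * k * S / Q%:R)))).
  apply: ler_wpM2l; first exact: expR_ge0.
  apply: (@le_trans _ _ (Q%:R * (1 + theta * k * S / Q%:R))).
    rewrite [leRHS]mulrDr mulr1; apply: lerD => //.
    by rewrite mulrCA divff ?mulr1 // gt_eqF.
  by apply: ler_wpM2l; [exact: ltW | exact: expR_ge1Dx].
rewrite mulrCA -expRD -[leRHS]mulr1; apply: ler_wpM2l; first exact: ltW.
rewrite expR_le1.
have -> : theta * c + theta * k * S / Q%:R = theta * (c + k * S / Q%:R) by ring.
exact: mulr_ge0_le0.
Qed.

(** Scaling by [Q] reduces the claim to the drift inequalities with [w = r Q / n] and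
    [tau = t n / r]. The edge error bound is what keeps [w d] within [15 r^2 a^2] of [d^2]. *)
Lemma degree_drift (r n d a A L D l Q S dv t sg : R) :
  regime r n d a A L D l -> 0 < Q -> 0 <= dv -> 0 <= S ->
  `|Q - n * d / r| <= 15 * r * n * (a ^+ 2 / d) ->
  `|dv - d| <= a ->
  S <= dv * ((r - 1) * (d + a)) ->
  dv * ((r - 1) * (d - a)) <= S + dv * (r ^+ 2 * L) ->
  (r - 1) * d - r ^+ 3 * L <= t * n / r -> t * n / r <= (r - 1) * d ->
  (sg == 1) || (sg == -1) ->
  a - A / 2 <= sg * (dv - d) ->
  sg * t - r ^+ 2 * A / n + (- sg + A / (2 * D)) * S / Q <= 0.
Proof.
move=> reg Q0 dv0 S0 Qd dvd Su Sl tl tu sg1 crit.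
have [h100 h10 h40 hL6 hL3] := regime_small reg.
case: reg => r2 n0 d0 dD A0 Aa a2 L0 l1 A2 dLn.
have r0 : 0 < r by lra.
have D0 : 0 < D by exact: lt_le_trans dD.
pose w := r * Q / n.
have wd : `|w * d - d ^+ 2| <= 15 * r ^+ 2 * a ^+ 2.
  have -> : w * d - d ^+ 2 = (r * d / n) * (Q - n * d / r) by rewrite /w; field; lra.
  have f0 : 0 <= r * d / n by rewrite divr_ge0 ?mulr_ge0 // ltW.
  rewrite normrM (ger0_norm f0); apply: le_trans (ler_wpM2l f0 Qd) _.
  by rewrite le_eqVlt; apply/orP; left; apply/eqP; field; lra.
have /andP[wl wu] : d ^+ 2 - 15 * r ^+ 2 * a ^+ 2 <= w * d
    <= d ^+ 2 + 15 * r ^+ 2 * a ^+ 2.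
  by move: wd; rewrite ler_norml => /andP[w1 w2]; apply/andP; split; lra.
have /andP[dvl dvu] : d - a <= dv <= d + a.
  by move: dvd; rewrite ler_norml => /andP[w1 w2]; apply/andP; split; lra.
rewrite -(pmulr_rle0 _ Q0).
have -> : Q * (sg * t - r ^+ 2 * A / n + (- sg + A / (2 * D)) * S / Q)
   = sg * (t * n / r * w - S) + A / (2 * D) * S - r * A * w.
  by rewrite /w; field; rewrite !gt_eqF.
case/orP: sg1 => /eqP sgE; rewrite {}sgE in crit *.
  rewrite mul1r; rewrite mul1r in crit.
  apply: (degree_drift_above r2 d0 dD A0 Aa h10 a2 (ltW L0) hL6 wu wl dv0 S0 Su Sl) => //.
  lra.
rewrite mulN1r opprB; rewrite mulN1r in crit.
apply: (degree_drift_below r2 d0 dD A0 Aa h10 a2 (ltW L0) hL6 wu wl dv0 S0 Su) => //.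
lra.
Qed.

(** [theta] is chosen so that a loss of at most [r L] has second-order factor
    [2/3 theta r L = A / (2 D)], which the error growth can pay for. With [A^2 = 6 r L D l] this
    gives [theta A / 2 = 9/4 l], so outside the critical window of width [A / 2] the exponential is
    small. *)
Lemma degree_step (r Lc : nat) G U v (d a A D l d' a' sg theta : R) :
  uniform r G -> (forall F, F \in G -> F \subset U) -> G != set0 ->
  (forall u w, u != w -> (pair_degree G u w <= Lc)%N) ->
  regime r%:R #|U|%:R d a A Lc%:R D l ->
  (forall v, v \in U -> `|(degree G v)%:R - d| <= a) ->
  `|#|G|%:R - #|U|%:R * d / r%:R| <= 15 * r%:R * #|U|%:R * (a ^+ 2 / d) ->
  (r%:R - 1) * d - r%:R ^+ 3 * Lc%:R <= (d - d') * #|U|%:R / r%:R ->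
  (d - d') * #|U|%:R / r%:R <= (r%:R - 1) * d ->
  a + r%:R ^+ 2 * A / #|U|%:R <= a' ->
  (sg == 1) || (sg == -1) -> v \in U ->
  theta = 3 / 4 * A / (r%:R * Lc%:R * D) ->
  \sum_(E in G | v \notin E)
      expR (theta * (sg * ((degree (delete_edge G E) v)%:R - d') - a'))
    <= #|G|%:R * (expR (theta * (sg * ((degree G v)%:R - d) - a))
                  + expR (1 - 9 / 4 * l)).
Proof.
move=> ur GU Gn hL reg dev Qd tl tu aa sg1 vU thE.
have [h100 h10 h40 hL6 hL3] := regime_small reg.
have [r2 n0 d0 dD A0 Aa a2 L0 l1 A2 dLn] := reg.
set rR : R := r%:R in r2 *; set n : R := #|U|%:R in n0 *.
set L : R := Lc%:R in L0 *.
set Q : R := #|G|%:R; set dv : R := (degree G v)%:R.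
have r0 : 0 < rR by lra.
have rn0 : (0 < r)%N by rewrite -(ltr0n R).
have D0 : 0 < D by lra.
have a0 : 0 < a by lra.
have Q0 : 0 < Q by rewrite ltr0n card_gt0.
pose x E : R := #|[set F in hitting G E | v \in F]|%:R.
pose t := d - d'; pose c := sg * t - rR ^+ 2 * A / n.
have rLD0 : 0 < rR * L * D by rewrite !mulr_gt0.
have th0 : 0 < theta by rewrite thE divr_gt0 // mulr_gt0 // divr_gt0.
have xb E : E \in G -> v \notin E -> 0 <= x E <= rR * L.
  move=> EG vE; rewrite ler0n -natrM ler_nat -(ur E EG) /=.
  exact: hitting_pair_le.
have step E : E \in G ->
    sg * ((degree (delete_edge G E) v)%:R - d') - a'
      <= sg * (dv - d) - a + (c - sg * x E).
  move=> EG; have E0 : E != set0 by rewrite -card_gt0 (ur E EG).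
  have : (degree (delete_edge G E) v)%:R + x E = dv.
    by rewrite -natrD degree_delete_edge.
  move=> <-; rewrite /c /t -/n; move: aa; rewrite -/n -/rR => aa.
  by rewrite -subr_ge0; set X := (X in 0 <= X);
    have -> : X = a' - (a + rR ^+ 2 * A / n) by [rewrite /X; ring]; lra.
have thb : theta * (rR * L) = 3 / 4 * (A / D).
  by rewrite thE; field; rewrite !gt_eqF.
have thA : theta * (A / 2) = 9 / 4 * l.
  have -> : theta * (A / 2) = 3 / 8 * A ^+ 2 / (rR * L * D).
    by rewrite thE; field; rewrite !gt_eqF.
  by rewrite A2; field; rewrite !gt_eqF.
have AD : rR * (A / D) <= 40^-1.
  rewrite mulrA ler_pdivrMr //.
  have : rR * A <= rR * a by rewrite ler_pM2l.
  lra.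
have AD1 : A / D <= 80^-1.
  have AD0 : 0 <= A / D by rewrite divr_ge0 // ltW.
  have : 2 * (A / D) <= rR * (A / D) by apply: ler_wpM2r.
  lra.
have tl' : 0 <= t.
  have : 0 <= t * n / rR.
    apply: le_trans tl; have : 1 * d <= (rR - 1) * d by apply: ler_wpM2r; lra.
    have : 2 * a <= rR * a by apply: ler_wpM2r; lra.
    move: hL3; rewrite -/rR -/L; lra.
  by rewrite -mulrA pmulr_lge0 // divr_gt0.
have tu' : t <= rR ^+ 2 * L.
  have tE : t = t * n / rR * (rR / n) by field; rewrite !gt_eqF.
  rewrite tE; apply: (@le_trans _ _ ((rR - 1) * d * (rR / n))).
    by apply: ler_wpM2r => //; rewrite divr_ge0 // ltW.
  have dn : d / n <= L by rewrite ler_pdivrMr.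
  have -> : (rR - 1) * d * (rR / n) = (rR - 1) * rR * (d / n) by ring.
  apply: ler_pM => //; first by rewrite mulr_ge0 //; lra.
    by rewrite divr_ge0 // ltW.
  by rewrite expr2; apply: ler_wpM2r; lra.
(* Below the window, one step raises the signed deviation by at most [r^2 L], and
   [theta r^2 L = 3/4 r A / D] is less than 1. *)
have [crit|ncrit] := lerP (a - A / 2) (sg * (dv - d)); last first.
  apply: (@le_trans _ _ (Q * expR (1 - 9 / 4 * l))); last first.
    by apply: ler_wpM2l; rewrite ?ler0n // lerDr expR_ge0.
  rewrite /Q mulr_natl -sumr_const big_mkcondr; apply: ler_sum => E EG.
  case: ifP => [vE|_]; last exact: expR_ge0.
  have /andP[x0 xr] := xb E EG vE.
  rewrite ler_expR; apply: (@le_trans _ _ (theta * (rR ^+ 2 * L - A / 2))).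
    apply: ler_wpM2l; first exact: ltW.
    apply: le_trans (step E EG) _.
    have rA : 0 <= rR ^+ 2 * A / n by rewrite divr_ge0 ?mulr_ge0 ?sqr_ge0 // ltW.
    have rL : rR * L <= rR ^+ 2 * L.
      rewrite expr2 -mulrA -[leLHS]mul1r; apply: ler_wpM2r; last lra.
      by rewrite mulr_ge0 // ltW.
    have : sg * t - sg * x E <= rR ^+ 2 * L.
      by case/orP: sg1 => /eqP ->; clear - rL x0 xr tl' tu'; lra.
    rewrite /c; clear - rA ncrit; lra.
  rewrite mulrBr thA expr2 -mulrA mulrCA thb; clear - AD AD1; lra.
have S0 : 0 <= \sum_(E in G | v \notin E) x E.
  by apply: sumr_ge0 => E _; rewrite ler0n.
have [Su Sl] := sum_hitting_pairs_bounds v rn0 ur GU hL dev.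
have drift := degree_drift reg Q0 (ler0n _ (degree G v)) S0 Qd (dev v vU)
  Su Sl tl tu sg1 crit.
apply: (@le_trans _ _ (Q * expR (theta * (sg * (dv - d) - a)))); last first.
  by rewrite [leRHS]mulrDr lerDl mulr_ge0 ?expR_ge0 // ler0n.
apply: (@le_trans _ _ (\sum_(E in G | v \notin E)
    (expR (theta * (sg * (dv - d) - a)) * expR (theta * (c - sg * x E))))).
  apply: ler_sum => E /andP[EG _]; rewrite -expRD ler_expR -mulrDr.
  by apply: ler_wpM2l; [exact: ltW | exact: step].
rewrite -mulr_sumr mulrC; apply: ler_wpM2r; first exact: expR_ge0.
apply: (@sum_expR_removed_le _ _ _ _ _ _ (rR * L)) => //.
- by apply: subset_leq_card; apply/subsetP => E /andP[].
- by rewrite card_gt0.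
- exact: ltW.
- rewrite thb; clear - AD1; lra.
- by move=> E /andP[EG vE]; exact: xb.
- rewrite -(mulrA _ theta) thb.
  by have -> : 2 / 3 * (3 / 4 * (A / D)) = A / (2 * D) by field; rewrite gt_eqF.
Qed.

End DegreeStep.

(** * Trajectories and error bounds *)

Section Trajectories.
Variable R : realType.

Lemma power_decrement (p x : R) k : 0 <= p -> 0 <= x <= 1 ->
  p ^+ k * (k%:R * x - (k%:R * x) ^+ 2) <= p ^+ k - (p * (1 - x)) ^+ k
    <= p ^+ k * (k%:R * x).
Proof.
move=> p0 x01; have pk : 0 <= p ^+ k by exact: exprn_ge0.
have := ler_wpM2l pk (bernoulli_le k x01).
have := ler_wpM2l pk (bernoulli_ge k x01).
by rewrite [(p * _) ^+ _]exprMn => h1 h2; apply/andP; split; lra.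
Qed.

Section Errors.
Variables (V : finType) (r D L : nat).
Local Notation N := (#|V|%:R : R).
Local Notation A := (Num.sqrt (6 * r%:R * L%:R * D%:R * ln N) : R).
Local Notation lam p := (1 - r%:R * ln p).
Local Notation ed := (err_d V r D L).
Local Notation eq := (err_q V r L).

Lemma lam_ge1 (p : R) : 0 < p <= 1 -> 1 <= lam p.
Proof.
move=> /andP[p0 p1]; rewrite lerDl oppr_ge0.
by apply: mulr_ge0_le0 => //; exact: ln_le0.
Qed.

(** Substituting the square of [e_d], with [90 = 15 * 6]. This ties the edge error to the degree
    error in the form used by the drift inequalities. *)
Lemma err_qE (p : R) : (1 < r)%N -> 0 < p -> (0 < D)%N -> 1 <= ln N ->
  eq p = 15 * r%:R * (N * p) * (ed p ^+ 2 / (D%:R * p ^+ r.-1)).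
Proof.
move=> r1 p0 D0 l1; rewrite /err_q /err_d exprMn sqr_sqrtr; last first.
  by rewrite !mulr_ge0 //; exact: le_trans l1.
have -> : p ^ (2%:Z - r%:Z) = p / p ^+ r.-1.
  apply: (mulIf (x := p ^+ r.-1)); first by rewrite expf_neq0 // gt_eqF.
  rewrite divfK ?expf_neq0 ?gt_eqF //.
  rewrite [p ^+ _]exprnP -expfzDr ?gt_eqF //.
  have -> : (2%:Z - r%:Z + r.-1%:Z)%R = 1 by lia.
  by rewrite expr1z.
have D1 : 0 < D%:R :> R by rewrite ltr0n.
by field; rewrite !gt_eqF ?exprn_gt0.
Qed.

Lemma regime_of_small (p : R) : (1 < r)%N -> (0 < D)%N -> (0 < L)%N ->
  1 <= ln N -> D%:R <= L%:R * N -> 0 < p <= 1 ->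
  100 * r%:R ^+ 3 * (A * lam p ^+ 2) <= D%:R * p ^+ r.-1 ->
  regime r%:R (N * p) (D%:R * p ^+ r.-1) (ed p) A L%:R D%:R (ln N).
Proof.
move=> r1 D0 L0 l1 DLN p01 small; have lam1 := lam_ge1 p01.
have /andP[p0 p1] := p01.
have r0 : (0 < r)%N by exact: ltnW.
have D0' : 0 < D%:R :> R by rewrite ltr0n.
have L0' : 0 < L%:R :> R by rewrite ltr0n.
have l0 : 0 < ln N by exact: lt_le_trans l1.
have A0 : 0 < A by rewrite sqrtr_gt0 !mulr_gt0 // ltr0n.
have N0 : 0 < N by rewrite -(pmulr_rgt0 _ L0'); exact: lt_le_trans DLN.
have pk0 : 0 < p ^+ r.-1 by exact: exprn_gt0.
have r2 : 2 <= r%:R :> R by rewrite (ler_nat _ 2).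
split=> //.
- exact: mulr_gt0.
- exact: mulr_gt0.
- by rewrite -[leRHS]mulr1; apply: ler_wpM2l; [exact: ltW | rewrite exprn_ile1 // ltW].
- by rewrite -[leLHS]mulr1 /err_d; apply: ler_wpM2l => //; exact: ltW.
- have -> : 100 * r%:R ^+ 3 * ed p ^+ 2 = A * (100 * r%:R ^+ 3 * (A * lam p ^+ 2)).
    by rewrite /err_d; ring.
  by apply: ler_wpM2l small; exact: ltW.
- by rewrite sqr_sqrtr // !mulr_ge0 // ltW.
- apply: (@le_trans _ _ (D%:R * p)).
    apply: ler_wpM2l; first exact: ltW.
    rewrite -[leRHS]expr1; apply: ler_wiXn2l => //; first exact: ltW.
    by case: (r) r1 => [|[]].
  by rewrite mulrA; apply: ler_wpM2r => //; exact: ltW.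
Qed.

Lemma err_q_le (p p' : R) : (1 < r)%N -> 0 <= ln N -> 0 < p' -> p' <= p -> p <= 1 ->
  eq p <= eq p'.
Proof.
move=> r1 l0 p'0 pp p1; have p0 : 0 < p by exact: lt_le_trans pp.
have inv_pow q : 0 < q -> q ^ (2%:Z - r%:Z) = (q ^+ (r - 2))^-1 :> R.
  move=> q0; have -> : (2%:Z - r%:Z)%R = - (r - 2)%N%:Z by lia.
  by rewrite exprnN.
have lamp : 0 <= lam p.
  by apply: le_trans (lam_ge1 _) => //; rewrite p0.
have lampp : lam p <= lam p'.
  rewrite lerD2l lerN2; apply: ler_wpM2l => //.
  by rewrite ler_ln ?posrE.
rewrite /err_q !inv_pow //; apply: ler_pM.
- by rewrite !mulr_ge0 // ?exprn_ge0 // invr_ge0 exprn_ge0 // ltW.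
- exact: sqr_ge0.
- apply: ler_wpM2r => //; apply: ler_wpM2l; first by rewrite !mulr_ge0 // exprn_ge0.
  rewrite lef_pV2 ?posrE ?exprn_gt0 //.
  by apply: lerXn2r => //; rewrite nnegrE ltW.
- by apply: lerXn2r => //; rewrite nnegrE // (le_trans lamp).
Qed.

(** From [- ln (1 - x) >= x]: the factor [1 - r log p] makes the degree error gain [r A x] per step,
    with [x = r / n]. *)
Lemma err_d_growth (p x : R) : 0 < p -> 0 <= x < 1 ->
  ed p + r%:R * A * x <= ed (p * (1 - x)).
Proof.
move=> p0 /andP[x0 x1]; rewrite /err_d.
have -> : ln (p * (1 - x)) = ln p + ln (1 - x).
  by rewrite lnM // posrE subr_gt0.
have lnx : ln (1 - x) <= - x.
  by rewrite -[leRHS]expRK ler_ln ?posrE ?subr_gt0 ?expR_gt0 // expR_ge1Dx.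
have rA : 0 <= r%:R * A by rewrite mulr_ge0 // sqrtr_ge0.
have := ler_wpM2l rA lnx; lra.
Qed.

End Errors.

Lemma frac_leftS (V : finType) (r i : nat) :
  frac_left V R r i.+1 = frac_left V R r i - r%:R / #|V|%:R.
Proof. by rewrite /frac_left -natr1; ring. Qed.

Lemma next_frac (n N p r : R) : 0 < n -> 0 < r -> n = N * p ->
  p - r / N = p * (1 - r / n).
Proof.
move=> n0 r0 nE; rewrite nE; field.
by apply/andP; split; apply: contraTneq n0 => e; rewrite nE e ?mulr0 ?mul0r ltxx.
Qed.

End Trajectories.

(** * The supermartingale potential *)

Section FailureProbability.
Variables (R : realType) (V : finType) (H : {set {set V}}) (r D : nat).
Variable pstar : R.
Implicit Types (G : {set {set V}}) (U E F : {set V}) (s : seq {set V}).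

Local Notation N := (#|V|%:R : R).
Local Notation L := (max_pair_degree H).
Local Notation A := (Num.sqrt (6 * r%:R * L%:R * D%:R * ln N) : R).
Local Notation ed := (err_d V r D L).
Local Notation eq := (err_q V r L).
Local Notation fr := (frac_left V R r).
Local Notation theta := (3 / 4 * A / (r%:R * L%:R * D%:R)).
Local Notation gain := (expR (1 - 9 / 4 * ln N)).

Definition run_inv i G U : Prop :=
  [/\ uniform r G, G \subset H, forall F, F \in G -> F \subset U
    & (#|U| + i * r = #|V|)%N].

Definition deviates i G U : bool :=
  (`|#|G|%:R - N * D%:R / r%:R * fr i ^+ r| > eq (fr i)) ||
  [exists v in U, `|(degree G v)%:R - D%:R * fr i ^+ r.-1| > ed (fr i)].

(** Only deviations above the threshold count as failures, since the conclusion only asks the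
    process to stay on track down to [pstar]. *)
Definition early_deviation i G U : bool := (pstar < fr i) && deviates i G U.

Definition edge_pot (sg : R) i G : R :=
  expR (D%:R^-1 * (sg * (#|G|%:R - N * D%:R / r%:R * fr i ^+ r) - eq (fr i))).

Definition degree_pot (sg : R) i G v : R :=
  expR (theta * (sg * ((degree G v)%:R - D%:R * fr i ^+ r.-1) - ed (fr i))).

(* The last term pays for the potentials of the quantities that are still far
   from their error bounds: in one step each of them grows to at most gain. *)
Definition potential i G U : R :=
  if pstar < fr i then
    \sum_(v in U) (degree_pot 1 i G v + degree_pot (-1) i G v)
    + (edge_pot 1 i G + edge_pot (-1) i G)
    + #|U|%:R * ((2 * N + 2) * gain)
  else 0.

Hypotheses (r1 : (1 < r)%N) (D0 : (0 < D)%N) (L0 : (0 < L)%N).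
Hypotheses (l1 : 1 <= ln N) (uH : uniform r H) (rH : regular D H).
Hypotheses (ps0 : 0 <= pstar).
Hypothesis small : forall p : R, pstar < p <= 1 ->
  100 * r%:R ^+ 3 * (A * (1 - r%:R * ln p) ^+ 2) <= D%:R * p ^+ r.-1.

Lemma card_V_gt0 : (0 < #|V|)%N.
(* [ln 0] is 0 by convention, which contradicts [1 <= ln N]. *)
Proof. by rewrite lt0n; apply: contraTneq l1 => ->; rewrite ln0 // -ltNge ltr01. Qed.

Let N0 : 0 < N. Proof. by rewrite ltr0n card_V_gt0. Qed.
Let r0 : (0 < r)%N. Proof. exact: ltnW. Qed.
Let rR0 : 0 < r%:R :> R. Proof. by rewrite ltr0n. Qed.

Lemma regular_le_pair_degree : D%:R <= L%:R * N.
Proof.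
rewrite -natrM ler_nat.
apply: leq_trans (degree_le_max_pair_degree r1 uH rH card_V_gt0).
by apply: leq_pmulr; case: (r) r1 => [|[]].
Qed.

Lemma run_inv_card i G U : run_inv i G U -> #|U|%:R = N * fr i.
Proof.
case=> _ _ _ /(congr1 (fun k => k%:R : R)).
rewrite natrD natrM /frac_left => h.
rewrite mulrBr mulr1 mulrC divfK ?gt_eqF //.
by rewrite -h addrK.
Qed.

Lemma frac_left_le1 i : fr i <= 1.
Proof. by rewrite lerBlDr lerDl divr_ge0 ?mulr_ge0. Qed.

Lemma run_inv_regime i G U : run_inv i G U -> pstar < fr i ->
  regime r%:R #|U|%:R (D%:R * fr i ^+ r.-1) (ed (fr i)) A L%:R D%:R (ln N).
Proof.
move=> iG ps; rewrite (run_inv_card iG); apply: regime_of_small => //.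
- exact: regular_le_pair_degree.
- by rewrite (le_lt_trans ps0 ps) frac_left_le1.
- by apply: small; rewrite ps frac_left_le1.
Qed.

Lemma nominal_edges (n p : R) : n = N * p ->
  n * (D%:R * p ^+ r.-1) / r%:R = N * D%:R / r%:R * p ^+ r.
Proof.
have -> : p ^+ r = p * p ^+ r.-1 by rewrite -exprS prednK.
by move=> ->; ring.
Qed.

Lemma run_inv_err_q i G U : run_inv i G U -> pstar < fr i ->
  eq (fr i) = 15 * r%:R * #|U|%:R * (ed (fr i) ^+ 2 / (D%:R * fr i ^+ r.-1)).
Proof.
move=> iG ps; rewrite (run_inv_card iG); apply: err_qE => //.
exact: le_lt_trans ps.
Qed.

Lemma run_inv_pair_degree i G U : run_inv i G U ->
  forall u w : V, u != w -> (pair_degree G u w <= L)%N.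
Proof.
move=> [_ GH _ _] u w uw.
exact: leq_trans (pair_degreeS _ _ GH) (pair_degree_le_max _ uw).
Qed.

Lemma run_inv0 : run_inv 0 H [set: V].
Proof. by split=> //; rewrite mul0n addn0 cardsT. Qed.

Lemma run_inv_step i G U E :
  run_inv i G U -> E \in G -> run_inv i.+1 (delete_edge G E) (U :\: E).
Proof.
move=> [ur GH GU cU] EG; split.
- by move=> F; rewrite !inE => /and3P[_ FG _]; exact: ur.
- apply/subsetP => F; rewrite !inE => /and3P[_ FG _].
  exact: (subsetP GH).
- move=> F; rewrite !inE => /and3P[_ FG FE].
  by rewrite subsetD (GU F FG) FE.
- have := cardsID E U; rewrite (setIidPr (GU E EG)) (ur E EG) -cU mulSn => <-.
  by rewrite [RHS]addnAC -addnA addnC addnA.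
Qed.

Lemma potential_ge0 i G U : 0 <= potential i G U.
Proof.
rewrite /potential; case: ifP => // _.
have pos (x : R) : 0 <= expR x by exact: expR_ge0.
rewrite !addr_ge0 ?pos // ?sumr_ge0 // => [v _|]; first by rewrite addr_ge0 ?pos.
by rewrite !mulr_ge0 ?addr_ge0 ?pos ?mulr_ge0.
Qed.

Lemma expR_signs_ge1 (c x e : R) : 0 <= c -> e < `|x| ->
  1 <= expR (c * (1 * x - e)) + expR (c * (-1 * x - e)).
Proof.
move=> c0 ex; have pos (y : R) : 0 <= expR y by exact: expR_ge0.
have ge1 (y : R) : 0 <= y -> 1 <= expR y.
  by move=> y0; apply: le_trans (expR_ge1Dx _); rewrite lerDl.
have [x0|x0] := lerP 0 x.
  rewrite ger0_norm // in ex; rewrite -[leLHS]addr0; apply: lerD => //.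
  by apply: ge1; rewrite mulr_ge0 // mul1r subr_ge0 ltW.
rewrite ltr0_norm // in ex; rewrite -[leLHS]add0r; apply: lerD => //.
by apply: ge1; rewrite mulr_ge0 // mulN1r subr_ge0 ltW.
Qed.

Lemma potential_ge1 i G U : early_deviation i G U -> 1 <= potential i G U.
Proof.
move=> /andP[ps]; rewrite /potential ps.
have pos (x : R) : 0 <= expR x by exact: expR_ge0.
have th0 : 0 <= theta by rewrite !mulr_ge0 ?invr_ge0 ?mulr_ge0 // sqrtr_ge0.
have rest : 0 <= #|U|%:R * ((2 * N + 2) * gain).
  by rewrite !mulr_ge0 ?addr_ge0 ?pos ?mulr_ge0.
have dp (v : V) : 0 <= degree_pot 1 i G v + degree_pot (-1) i G v.
  by rewrite addr_ge0 ?pos.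
case/orP=> [dev|/existsP[v /andP[vU dev]]].
  rewrite -[leLHS]addr0; apply: lerD => //.
  rewrite -[leLHS]add0r; apply: lerD; first by apply: sumr_ge0.
  by apply: expR_signs_ge1 => //; rewrite invr_ge0.
rewrite -[leLHS]addr0; apply: lerD => //.
rewrite -[leLHS]addr0; apply: lerD; last by rewrite addr_ge0 ?pos.
rewrite (bigD1 v) //= -[leLHS]addr0; apply: lerD; last by apply: sumr_ge0.
exact: expR_signs_ge1.
Qed.

Section Step.
Variables (i : nat) (G : {set {set V}}) (U : {set V}) (sg : R).
Hypotheses (iG : run_inv i G U) (ps : pstar < fr i) (ps' : pstar < fr i.+1).
Hypotheses (nd : ~~ deviates i G U) (G0 : G != set0).
Hypothesis sg1 : (sg == 1) || (sg == -1).

Let p0 : 0 < fr i. Proof. exact: le_lt_trans ps. Qed.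
Let reg := run_inv_regime iG ps.
Let n0 : 0 < #|U|%:R :> R. Proof. by case: reg. Qed.
Let x : R := r%:R / #|U|%:R.
Let x0 : 0 <= x. Proof. by rewrite divr_ge0. Qed.

Let frS : fr i.+1 = fr i * (1 - x).
Proof. by rewrite frac_leftS; apply: next_frac => //; exact: run_inv_card iG. Qed.

Let x1 : x < 1.
Proof.
have : 0 < fr i * (1 - x) by rewrite -frS; exact: le_lt_trans ps'.
by rewrite pmulr_rgt0 // subr_gt0.
Qed.

Let degree_ok v : v \in U ->
  `|(degree G v)%:R - D%:R * fr i ^+ r.-1| <= ed (fr i).
Proof.
move: nd; rewrite negb_or negb_exists => /andP[_ /forallP/(_ v)].
by move=> + vU; rewrite vU /= -leNgt.
Qed.

Let nominal_ratio : D%:R * fr i ^+ r.-1 / #|U|%:R <= L%:R.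
Proof. by rewrite ler_pdivrMr //; case: reg. Qed.

Lemma edge_pot_step :
  \sum_(E in G) edge_pot sg i.+1 (delete_edge G E)
    <= #|G|%:R * (edge_pot sg i G + gain).
Proof.
have [ur _ GU _] := iG; have nE := run_inv_card iG.
have x01 : 0 <= x <= 1 by rewrite x0 ltW.
have /andP[dl du] := power_decrement r (ltW p0) x01.
rewrite -frS in dl du.
set d := D%:R * fr i ^+ r.-1.
have qE := nominal_edges nE; rewrite -/d in qE.
have c0 : 0 <= N * D%:R / r%:R by rewrite divr_ge0 // mulr_ge0.
have qd : N * D%:R / r%:R * fr i ^+ r * (r%:R * x) = r%:R * d.
  by rewrite -qE /x; field; rewrite !gt_eqF.
have dL : d / #|U|%:R <= L%:R := nominal_ratio.
rewrite /edge_pot -qE (run_inv_err_q iG ps) -/d.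
apply: (edge_step ur GU (run_inv_pair_degree iG) reg degree_ok) => //.
- rewrite qE -mulrBr; apply: le_trans (ler_wpM2l c0 dl).
  have -> : N * D%:R / r%:R * (fr i ^+ r * (r%:R * x - (r%:R * x) ^+ 2))
    = r%:R * d - r%:R ^+ 3 * (d / #|U|%:R).
    rewrite -[r%:R * d]qd.
    have -> : d / #|U|%:R = (r%:R * d) * x / r%:R ^+ 2.
      by rewrite /x; field; rewrite !gt_eqF.
    by rewrite -qd; field; rewrite gt_eqF.
  by rewrite lerD2l lerN2; apply: ler_wpM2l => //; exact: exprn_ge0.
- by rewrite qE -mulrBr; apply: le_trans (ler_wpM2l c0 du) _;
  rewrite (mulrA _ (fr i ^+ r)) qd.
- rewrite -(run_inv_err_q iG ps); apply: err_q_le => //.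
  + by apply: le_trans l1.
  + exact: le_lt_trans ps'.
  + by rewrite frS -[leRHS]mulr1; apply: ler_wpM2l; [exact: ltW | rewrite gerBl].
  + exact: frac_left_le1.
Qed.

Lemma degree_pot_step :
  \sum_(E in G) \sum_(v in U :\: E) degree_pot sg i.+1 (delete_edge G E) v
    <= #|G|%:R * (\sum_(v in U) degree_pot sg i G v + #|U|%:R * gain).
Proof.
have [ur _ GU _] := iG; have nE := run_inv_card iG.
have x01 : 0 <= x <= 1 by rewrite x0 ltW.
have /andP[dl du] := power_decrement r.-1 (ltW p0) x01.
rewrite -frS in dl du.
have rE : r.-1%:R = r%:R - 1 :> R by rewrite -[in RHS](prednK r0) -natr1 addrK.
set d := D%:R * fr i ^+ r.-1.
have dL : d / #|U|%:R <= L%:R := nominal_ratio.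
have edge_ok : `|#|G|%:R - #|U|%:R * d / r%:R|
    <= 15 * r%:R * #|U|%:R * (ed (fr i) ^+ 2 / d).
  rewrite -(run_inv_err_q iG ps) (nominal_edges nE).
  by move: nd; rewrite negb_or -leNgt => /andP[].
have sc0 : 0 <= D%:R * (#|U|%:R / r%:R) :> R by rewrite mulr_ge0 // divr_ge0.
have -> : \sum_(v in U) degree_pot sg i G v + #|U|%:R * gain
    = \sum_(v in U) (degree_pot sg i G v + gain).
  by rewrite big_split /= sumr_const mulr_natl.
rewrite (eq_bigr (fun E => \sum_(v in U | v \notin E)
    degree_pot sg i.+1 (delete_edge G E) v)); last first.
  by move=> E _; apply: eq_bigl => v; rewrite !inE andbC.
(* For fixed [v] only the edges avoiding [v] remain: choosing an edge through [v] removes [v] and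
   its potential. *)
rewrite (exchange_big_dep (mem U)) /=; last by move=> E v _ /andP[].
rewrite mulr_sumr; apply: ler_sum => v vU.
rewrite (eq_bigl (fun E => (E \in G) && (v \notin E))); last first.
  by move=> E; rewrite vU.
rewrite /degree_pot -/d.
apply: (degree_step ur GU G0 (run_inv_pair_degree iG) reg degree_ok edge_ok) => //.
- have -> : (d - D%:R * fr i.+1 ^+ r.-1) * #|U|%:R / r%:R
      = D%:R * (#|U|%:R / r%:R) * (fr i ^+ r.-1 - fr i.+1 ^+ r.-1).
    by rewrite /d; ring.
  apply: le_trans (ler_wpM2l sc0 dl); rewrite -rE.
  have -> : D%:R * (#|U|%:R / r%:R)
      * (fr i ^+ r.-1 * (r.-1%:R * x - (r.-1%:R * x) ^+ 2))
    = r.-1%:R * d - r.-1%:R ^+ 2 * (r%:R * (d / #|U|%:R)).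
    by rewrite /d /x; field; rewrite !gt_eqF.
  have -> : r%:R ^+ 3 * L%:R = r%:R ^+ 2 * (r%:R * L%:R) :> R by ring.
  rewrite lerD2l lerN2; apply: ler_pM.
  + exact: exprn_ge0.
  + by rewrite mulr_ge0 // divr_ge0 // mulr_ge0 // exprn_ge0 // ltW.
  + by apply: lerXn2r; rewrite ?nnegrE // ler_nat leq_pred.
  + exact: ler_wpM2l.
- have -> : (d - D%:R * fr i.+1 ^+ r.-1) * #|U|%:R / r%:R
      = D%:R * (#|U|%:R / r%:R) * (fr i ^+ r.-1 - fr i.+1 ^+ r.-1).
    by rewrite /d; ring.
  apply: le_trans (ler_wpM2l sc0 du) _; rewrite -rE le_eqVlt.
  by apply/orP; left; apply/eqP; rewrite /d /x; field; rewrite !gt_eqF.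
- have -> : ed (fr i) + r%:R ^+ 2 * A / #|U|%:R = ed (fr i) + r%:R * A * x.
    by rewrite /x; ring.
  by rewrite frS; apply: err_d_growth; rewrite ?p0 ?x0.
Qed.

End Step.

Lemma potential_step i G U :
  run_inv i G U -> ~~ early_deviation i G U -> G != set0 ->
  \sum_(E in G) potential i.+1 (delete_edge G E) (U :\: E)
    <= #|G|%:R * potential i G U.
Proof.
move=> iG; rewrite /early_deviation => nd G0.
(* Once the threshold is passed the potential is 0 by definition. *)
have [ps'|ps'] := boolP (pstar < fr i.+1); last first.
  rewrite big1 ?mulr_ge0 ?potential_ge0 // => E _.
  by rewrite /potential (negbTE ps').
have ps : pstar < fr i.
  apply: lt_le_trans ps' _; rewrite frac_leftS gerBl.
  exact: divr_ge0.
rewrite ps /= in nd.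
have [ur _ GU _] := iG.
rewrite {2}/potential ps; under eq_bigr do rewrite /potential ps' big_split /=.
rewrite !big_split /=.
have pm : ((1 : R) == 1) || ((1 : R) == -1) by rewrite eqxx.
have nm : ((-1 : R) == 1) || ((-1 : R) == -1) by rewrite eqxx orbT.
have e1 := edge_pot_step iG ps ps' nd pm.
have e2 := edge_pot_step iG ps ps' nd nm.
have d1 := degree_pot_step iG ps ps' nd G0 pm.
have d2 := degree_pot_step iG ps ps' nd G0 nm.
have UN : #|U|%:R <= N by rewrite ler_nat max_card.
have Q0 : 0 <= #|G|%:R :> R by [].
(* Every step removes at least one vertex, so the reserve falls by at least [(2 N + 2) gain]. This
   pays for the at most [2 #|U| + 2] copies of [gain] created in the step. *)
have hlast : \sum_(E in G) #|U :\: E|%:R * ((2 * N + 2) * gain)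
    <= #|G|%:R * ((#|U|%:R - 1) * ((2 * N + 2) * gain)).
  rewrite [leRHS]mulr_natl -[leRHS]sumr_const; apply: ler_sum => E EG.
  apply: ler_wpM2r; first by rewrite !mulr_ge0 ?addr_ge0 ?mulr_ge0 ?expR_ge0.
  rewrite lerBrDr natr1 ler_nat -(cardsID E U) (setIidPr (GU E EG)) (ur E EG).
  by rewrite -[leqLHS]add1n leq_add2r.
have hgain : #|G|%:R * (2 * #|U|%:R * gain + 2 * gain)
    <= #|G|%:R * ((2 * N + 2) * gain).
  apply: ler_wpM2l => //; rewrite -mulrDl; apply: ler_wpM2r; first exact: expR_ge0.
  by rewrite lerD2r; apply: ler_wpM2l.
lra.
Qed.

(** By regularity all deviations vanish at the start, so every exponent is at most [- 9/2 log N],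
    well below that of [gain]. *)
Lemma potential0 : potential 0 H [set: V] <= 8 * N ^+ 2 * gain.
Proof.
have fr0 : fr 0 = 1 by rewrite /frac_left !mul0r subr0.
have g0 : 0 <= gain by exact: expR_ge0.
have N1 : 1 <= N by rewrite (ler_nat _ 1) card_V_gt0.
rewrite /potential; case: ifPn => [ps|_]; last first.
  by rewrite !mulr_ge0 // exprn_ge0.
have iH := run_inv0; have reg := run_inv_regime iH ps.
rewrite cardsT.
have dp sg v : degree_pot sg 0 H v <= gain.
  rewrite /degree_pot fr0 expr1n mulr1 rH subrr mulr0 sub0r ler_expR.
  have -> : ed 1 = A by rewrite /err_d ln1 mulr0 subr0 mulr1.
  have [_ _ _ _ AA _ _ LL _ A2 _] := reg.
  have -> : theta * - A = - (3 / 4 * A ^+ 2 / (r%:R * L%:R * D%:R)).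
    by ring.
  rewrite A2.
  have -> : 3 / 4 * (6 * r%:R * L%:R * D%:R * ln N) / (r%:R * L%:R * D%:R)
    = 9 / 2 * ln N by field; rewrite !gt_eqF ?ltr0n.
  have := l1; lra.
have ep sg : edge_pot sg 0 H <= gain.
  rewrite /edge_pot.
  have -> : #|H|%:R = N * D%:R / r%:R * fr 0 ^+ r :> R.
    rewrite fr0 expr1n mulr1 -natrM.
    have := sum_degree_uniform uH (fun F _ => subsetT F).
    under eq_bigr do rewrite rH.
    rewrite sum_nat_const cardsT => ->; rewrite natrM mulrAC divff ?mul1r //.
    by rewrite gt_eqF.
  rewrite subrr mulr0 sub0r ler_expR mulrN (run_inv_err_q iH ps).
  have := regime_edge_gain reg; have := l1.
  set X := 15 * _ * _ * _ => l1' h; have : D%:R^-1 * (X / 2) = D%:R^-1 * X / 2 by ring.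
  move: h l1'; lra.
apply: (@le_trans _ _ (\sum_(v in [set: V]) (gain + gain) + (gain + gain)
    + N * ((2 * N + 2) * gain))).
  rewrite lerD2r; apply: lerD; last exact: lerD.
  by apply: ler_sum => v _; exact: lerD.
rewrite sumr_const cardsT -[X in X + _ + _]mulr_natl.
have : (N + N * N) * gain <= 2 * (N * N) * gain.
  apply: ler_wpM2r => //; have : N * 1 <= N * N by apply: ler_wpM2l.
  lra.
have : gain <= N * N * gain.
  rewrite -[leLHS]mul1r; apply: ler_wpM2r => //.
  by rewrite -[leLHS]mulr1; apply: ler_pM.
rewrite expr2; lra.
Qed.

(** If no step satisfies the stopping condition, then [T = M], where no edges remain; above the
    threshold this is itself a deviation of [Q]. *)
Lemma early_stop s : greedy_run H s ->
  pstar < fr (stopping_time R r D L s H) ->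
  ever_bad early_deviation 0 H [set: V] s.
Proof.
move=> run; set T := stopping_time _ _ _ _ _ _ => psT.
suff [Ts dev] : (T <= size s)%N /\
    deviates T (remaining H s T) (unsaturated s T).
  by apply: (ever_badP Ts); rewrite add0n /early_deviation psT.
pose stop := stops_at R r D L s H; pose steps := iota 0 (size s).+1.
have TE : T = if has stop steps then find stop steps else size s by [].
have [hs|hs] := boolP (has stop steps).
  rewrite hs in TE.
  (* The list has [M + 1] entries, so a successful [find] returns an index at most [M]. *)
  have Ts : (T < (size s).+1)%N by rewrite TE -[X in (_ < X)%N](size_iota 0) -has_find.
  split=> //; have := nth_find 0%N hs.
  by rewrite -TE nth_iota // add0n => /andP[].
rewrite (negbTE hs) in TE.
split; first by rewrite TE.
have iT : run_inv T (remaining H s T) (unsaturated s T).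
  have [/forallP valid _] := andP run.
  suff inv_le j : (j <= size s)%N -> run_inv j (remaining H s j) (unsaturated s j).
    by apply: inv_le; rewrite TE.
  elim: j => [_|j IH js]; first by rewrite remaining0 /unsaturated take0; exact: run_inv0.
  have := run_inv_step (IH (ltnW js)) (valid (Ordinal js)).
  by rewrite /= /remaining /unsaturated (take_nth set0 js) !foldl_rcons.
have reg := run_inv_regime iT psT.
have [_ _ h40 _ _] := regime_small reg.
have rem0 : remaining H s T = set0 by move: run; rewrite TE => /andP[_ /eqP].
rewrite /deviates rem0 cards0 sub0r normrN.
rewrite -(nominal_edges (run_inv_card iT)) (run_inv_err_q iT psT).
have [r2 n0 d0 _ A0 Aa _ _ _ _ _] := reg.
have rp := rR0; clear reg rem0 iT.
move: h40 n0 d0 Aa A0 rp.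
set d := D%:R * _; set a := ed _; set n := #|_|%:R; set rR := r%:R.
move=> h40 n0 d0 Aa A0 rp.
apply/orP; left.
have a0 : 0 < a by exact: lt_le_trans Aa.
(* With the common factor [n / (r d)] taken out, the claim is [15 (r a)^2 < d^2], which follows from
   [40 r a <= d]. *)
have -> : n * d / rR = n / rR / d * d ^+ 2 by field; rewrite !gt_eqF.
have -> : 15 * rR * n * (a ^+ 2 / d) = n / rR / d * (15 * (rR * a) ^+ 2).
  by field; rewrite !gt_eqF.
rewrite ger0_norm; last by rewrite mulr_ge0 ?sqr_ge0 // !divr_ge0 // ltW.
rewrite ltr_pM2l ?divr_gt0 //.
have ra0 : 0 < rR * a by rewrite mulr_gt0.
apply: (@lt_le_trans _ _ ((40 * (rR * a)) ^+ 2)).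
  by rewrite [ltRHS]exprMn ltr_pM2r ?exprn_gt0 //; lra.
apply: lerXn2r; last by rewrite mulrA.
  by rewrite nnegrE mulr_ge0 // ltW.
by rewrite nnegrE ltW.
Qed.

Lemma greedy_prob_early_stop :
  greedy_prob R H (fun s => pstar < fr (stopping_time R r D L s H))
    <= 8 * N ^+ 2 * gain.
Proof.
apply: le_trans potential0; apply: le_trans (greedy_prob_le R early_stop) _.
apply: (greedy_prob_ever_bad potential_ge0 _ run_inv_step potential_step run_inv0).
by move=> i G U _; exact: potential_ge1.
Qed.

End FailureProbability.

From mathcomp Require Import all_classical all_reals all_analysis.
Import numFieldNormedType.Exports.

(** * The explicit threshold and the failure probability *)

Section SmallRegime.
Variable R : realType.

Lemma powR_expn_inv (x e : R) m : 0 <= x -> (0 < m)%N ->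
  (x `^ (e / m%:R)) ^+ m = x `^ e.
Proof.
move=> x0 m0; rewrite -powR_mulrn ?powR_ge0 // -powRrM divfK //.
by rewrite pnatr_eq0 -lt0n.
Qed.

(** Both sides are squared. The left side then has one logarithm from [A^2] and four from
    [(1 - r log p)^4], as the latter factor is at most [r l]; the right side contains
    [p^(2 (r - 1))], at least [C^2 (L / D) l^5]. This explains both exponents, and [C = 300 r^6]
    suffices because [6 * 100^2 r^11 <= C^2]. *)
Lemma small_of_threshold (r : nat) (N L D l p : R) :
  (1 < r)%N -> 0 < N -> 0 < L -> 0 < D -> D <= L * N -> l = ln N -> 1 <= l ->
  300 * r%:R ^+ 6 * ((L / D) `^ (1 / (2 * (r%:R - 1)))
                     * l `^ (5 / (2 * (r%:R - 1)))) < p <= 1 ->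
  100 * r%:R ^+ 3 * (Num.sqrt (6 * r%:R * L * D * l) * (1 - r%:R * ln p) ^+ 2)
    <= D * p ^+ r.-1.
Proof.
move=> r1 N0 L0 D0 DLN lE l1 /andP[psp p1].
set C := 300 * r%:R ^+ 6 in psp; have CE : C = 300 * r%:R ^+ 6 by [].
set y := _ `^ _ in psp; set z := _ `^ _ in psp.
set k := r.-1; have k0 : (0 < k)%N by rewrite /k; case: (r) r1 => [|[]].
have r2 : 2 <= r%:R :> R by rewrite (ler_nat _ 2).
have mE : 2 * (r%:R - 1) = (2 * k)%N%:R :> R.
  by rewrite natrM /k -subn1 natrB // ltnW.
have l0 : 0 < l by exact: lt_le_trans l1.
have x0 : 0 < L / D by rewrite divr_gt0.
have yE : y ^+ (2 * k) = L / D.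
  by rewrite /y mE powR_expn_inv ?muln_gt0 ?powRr1 // ltW.
have zE : z ^+ (2 * k) = l ^+ 5.
  by rewrite /z mE powR_expn_inv ?muln_gt0 ?powR_mulrn // ltW.
have y0 : 0 <= y by exact: powR_ge0.
have z0 : 0 <= z by exact: powR_ge0.
have [rR rE] : exists x : R, x = r%:R by exists r%:R.
rewrite -rE in r2 CE *; clearbody C y z.
have r61 : 1 <= rR ^+ 6 by rewrite expr_ge1 //; lra.
have C1 : 1 <= C by rewrite CE; lra.
have C0 : 0 <= C by exact: le_trans C1.
have ps0 : 0 <= C * (y * z) by rewrite !mulr_ge0.
have p0 : 0 < p by exact: le_lt_trans psp.
have xl0 : 0 <= L / D * l ^+ 5 by rewrite mulr_ge0 ?exprn_ge0 // ltW.
have C2 : 1 <= C ^+ 2 by exact: exprn_ege1.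
have CC : C ^+ 2 <= C ^+ (2 * k) by rewrite exprM ler_eXnr.
have pm : C ^+ 2 * (L / D * l ^+ 5) <= p ^+ (2 * k).
  apply: (@le_trans _ _ ((C * (y * z)) ^+ (2 * k))); last first.
    by apply: lerXn2r; rewrite ?nnegrE //; exact: ltW.
  by rewrite !exprMn yE zE; apply: ler_wpM2r.
have xp : L / D <= p ^+ (2 * k).
  apply: le_trans pm.
  have l51 : 1 <= l ^+ 5 by exact: exprn_ege1.
  have h : L / D * 1 <= L / D * l ^+ 5 by apply: ler_wpM2l => //; exact: ltW.
  have h' : 1 * (L / D * l ^+ 5) <= C ^+ 2 * (L / D * l ^+ 5) by exact: ler_wpM2r.
  by apply: le_trans h'; rewrite mul1r -[leLHS]mulr1.
(* From [1 / N <= L / D <= p^(2 (r - 1))], and [ln p <= 0] allows the exponent to be lowered to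
   2. *)
have lnp : - l <= 2 * ln p.
  have Nx : N^-1 <= L / D.
    by rewrite ler_pdivlMr // mulrC ler_pdivrMr.
  have : ln N^-1 <= ln (p ^+ (2 * k)).
    rewrite ler_ln ?posrE ?invr_gt0 ?exprn_gt0 //; exact: le_trans xp.
  rewrite lnV ?posrE // -lE lnXn // => /le_trans; apply.
  rewrite -[leLHS]mulr_natl; apply: ler_wnM2r; first exact: ln_le0.
  by rewrite (ler_nat _ 2) leq_pmulr.
set lam := 1 - rR * ln p.
have lam1 : 1 <= lam.
  rewrite lerDl oppr_ge0; apply: mulr_ge0_le0; last exact: ln_le0.
  lra.
have lamu : lam <= rR * l.
  have h : rR * - l <= rR * (2 * ln p) by apply: ler_wpM2l => //; lra.
  have h' : 2 * 1 <= rR * l by apply: ler_pM.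
  rewrite /lam; lra.
have Dp0 : 0 <= D * p ^+ k by rewrite mulr_ge0 ?exprn_ge0 // ltW.
have rR0 : 0 < rR by exact: lt_le_trans r2.
have s0 : 0 <= 6 * rR * L * D * l by rewrite !mulr_ge0 // ltW.
rewrite -(@ler_pXn2r _ 2) ?nnegrE //; last first.
  have lam0 : 0 <= lam by exact: le_trans lam1.
  by rewrite !mulr_ge0 ?sqrtr_ge0 // ltW.
have [h hE] : exists h : R, h = 100 by exists 100.
rewrite -hE; set S := Num.sqrt _.
have -> : (h * rR ^+ 3 * (S * lam ^+ 2)) ^+ 2 = h ^+ 2 * rR ^+ 6 * (S ^+ 2 * lam ^+ 4).
  by ring.
rewrite sqr_sqrtr // [leRHS]exprMn -exprM [(k * 2)%N]mulnC.
apply: (@le_trans _ _ (D ^+ 2 * (C ^+ 2 * (L / D * l ^+ 5)))); last first.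
  by apply: ler_wpM2l => //; exact: sqr_ge0.
have -> : D ^+ 2 * (C ^+ 2 * (L / D * l ^+ 5)) = C ^+ 2 * (L * D * l ^+ 5).
  by field; rewrite gt_eqF.
have {CE}-> : C = 3 * (h * rR ^+ 6) by rewrite CE hE; ring.
apply: (@le_trans _ _ (h ^+ 2 * rR ^+ 6
    * (6 * rR * L * D * l * (rR * l) ^+ 4))).
  apply: ler_wpM2l; first by rewrite mulr_ge0 ?sqr_ge0 // exprn_ge0 // ltW.
  apply: ler_wpM2l => //; apply: lerXn2r; rewrite ?nnegrE //.
    exact: le_trans lam1.
  by rewrite mulr_ge0 // ltW.
have -> : h ^+ 2 * rR ^+ 6 * (6 * rR * L * D * l * (rR * l) ^+ 4)
    = 6 * (h ^+ 2 * rR ^+ 11 * (L * D * l ^+ 5)) by ring.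
have -> : (3 * (h * rR ^+ 6)) ^+ 2 * (L * D * l ^+ 5)
    = 9 * rR * (h ^+ 2 * rR ^+ 11 * (L * D * l ^+ 5)) by ring.
apply: ler_wpM2r; last lra.
have [L0' D0' l0'] := And3 (ltW L0) (ltW D0) (ltW l0).
apply: mulr_ge0; first by rewrite mulr_ge0 ?sqr_ge0 ?exprn_ge0 // ltW.
by rewrite mulr_ge0 ?exprn_ge0 // mulr_ge0.
Qed.

(** The left side is [8 e N^(-1/4)]; the inequality [exp (- t) <= 1 / t] at [t = log N / 4] turns it
    into a bound that visibly tends to 0. *)
Lemma failure_bound_le (N : R) : 0 < N -> 1 <= ln N ->
  8 * N ^+ 2 * expR (1 - 9 / 4 * ln N) <= 32 * expR 1 / ln N.
Proof.
move=> N0 l1; have -> : N ^+ 2 = expR (2 * ln N).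
  by rewrite expRM_natl lnK.
rewrite -mulrA -expRD.
have -> : 2 * ln N + (1 - 9 / 4 * ln N) = 1 + - (4^-1 * ln N) by field.
rewrite expRD expRN.
have l0 : 0 < ln N by exact: lt_le_trans l1.
have -> : 32 * expR 1 / ln N = 8 * (expR 1 * (4^-1 * ln N)^-1) :> R.
  by field; rewrite gt_eqF.
do 2![apply: ler_wpM2l; rewrite ?expR_ge0 //].
rewrite lef_pV2 ?posrE ?expR_gt0 ?mulr_gt0 //.
by apply: le_trans (expR_ge1Dx _); rewrite lerDr.
Qed.

(** A bound for each single hypergraph. The complement of the event is [pstar < p(T)], whose
    probability [greedy_prob_early_stop] controls. *)
Lemma greedy_prob_success (r D : nat) (V : finType) (H : {set {set V}}) :
  (1 < r)%N -> (0 < D)%N -> 1 <= ln (#|V|%:R : R) -> uniform r H -> regular D H ->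
  1 - 32 * expR 1 / ln (#|V|%:R : R) <=
  greedy_prob R H (fun s =>
    let N : R := #|V|%:R in
    let L := max_pair_degree H in
    let T := stopping_time R r D L s H in
    N - T%:R * r%:R <=
      300 * r%:R ^+ 6 * (N * (L%:R / D%:R) `^ (1 / (2 * (r%:R - 1)))
                         * (ln N) `^ (5 / (2 * (r%:R - 1))))).
Proof.
move=> r1 D0 l1 uH rH; set N : R := #|V|%:R in l1 *.
set L := max_pair_degree H.
have N0 : 0 < N by rewrite ltr0n; exact: (card_V_gt0 l1).
have DLN : D%:R <= L%:R * N by apply: (regular_le_pair_degree r1).
have D0' : 0 < D%:R :> R by rewrite ltr0n.
have L0 : (0 < L)%N.
  rewrite lt0n; apply/negP => /eqP L0; move: DLN; rewrite L0 mul0r.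
  by rewrite leNgt D0'.
set A := (X in greedy_prob _ _ X).
set ps := 300 * r%:R ^+ 6 * ((L%:R / D%:R) `^ (1 / (2 * (r%:R - 1)))
                     * (ln N) `^ (5 / (2 * (r%:R - 1)))) : R.
have ps0 : 0 <= ps.
  apply: mulr_ge0; last by apply: mulr_ge0; exact: powR_ge0.
  by rewrite mulr_ge0 ?ler0n // exprn_ge0.
have small (p : R) : ps < p <= 1 -> 100 * r%:R ^+ 3 *
    (Num.sqrt (6 * r%:R * L%:R * D%:R * ln N) * (1 - r%:R * ln p) ^+ 2)
      <= D%:R * p ^+ r.-1.
  have L0' : 0 < L%:R :> R by rewrite ltr0n.
  exact: (small_of_threshold r1 N0 L0' D0' DLN erefl l1).
have fail := greedy_prob_early_stop r1 D0 L0 l1 uH rH ps0 small.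
rewrite -[X in X - _ <= _](greedy_prob_predC R H A) lerBlDr lerD2l.
apply: le_trans (failure_bound_le N0 l1); apply: le_trans fail.
apply: greedy_prob_le => s _ /=; rewrite /A -ltNge => h.
rewrite -(ltr_pM2l N0).
(* [N p(T) = N - T r], so the threshold for [p] becomes the bound on the unsaturated vertices. *)
have -> : N * frac_left V R r (stopping_time R r D L s H)
    = N - (stopping_time R r D L s H)%:R * r%:R.
  by rewrite /frac_left -/N; field; rewrite gt_eqF.
apply: le_lt_trans h; rewrite /ps le_eqVlt; apply/orP; left; apply/eqP; ring.
Qed.

End SmallRegime.

(** * The limit as the number of vertices tends to infinity *)

Local Open Scope classical_set_scope.

Theorem theorem2p1 (R : realType) (r : nat) (V : nat -> finType)
    (H : forall n, {set {set V n}}) (D : nat -> nat) :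
  (2 <= r)%N ->
  (#|V n| @[n --> \oo] --> \oo) ->
  (D n @[n --> \oo] --> \oo) ->
  (forall n, uniform r (H n)) ->
  (forall n, regular (D n) (H n)) ->
  (fun n => (max_pair_degree (H n))%:R : R^o)
    =o_\oo (fun n => (D n)%:R / ln (#|V n|%:R : R) ^+ 5 : R^o) ->
  exists2 C : R, 0 < C &
    greedy_prob R (H n) (fun s : seq {set V n} =>
      let N : R := #|V n|%:R in
      let L := max_pair_degree (H n) in
      let T := stopping_time R r (D n) L s (H n) in
      N - T%:R * r%:R <=
        C * (N * (L%:R / (D n)%:R) `^ (1 / (2 * (r%:R - 1)))
             * (ln N) `^ (5 / (2 * (r%:R - 1)))))
    @[n --> \oo] --> (1 : R).
Proof.
move=> r1 Voo Doo uH rH _; exists (300 * r%:R ^+ 6).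
  by rewrite mulr_gt0 ?ltr0n // exprn_gt0 // ltr0n ltnW.
apply/cvgrPdist_le => e e0.
(* If [ln N >= M], then [32 exp 1 / ln N <= e]; the summand 1 also secures [1 <= ln N]. *)
pose M : R := 1 + 32 * expR 1 / e.
have K0 : 0 < 32 * expR 1 :> R by rewrite mulr_gt0 ?expR_gt0.
have M1 : 1 <= M by rewrite lerDl divr_ge0 // ltW.
have /cvgnyPge/(_ (Num.bound (expR M))) largeV := Voo.
have /cvgnyPge/(_ 1%N) largeD := Doo.
near=> n.
have lM : M <= ln (#|V n|%:R : R).
  have eMN : expR M <= #|V n|%:R.
    apply: le_trans (ltW (archi_boundP (expR_ge0 M))) _.
    by rewrite ler_nat; near: n.
  rewrite -[leLHS]expRK ler_ln ?posrE ?expR_gt0 //.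
  exact: lt_le_trans (expR_gt0 M) eMN.
have Dn : (0 < D n)%N by near: n.
have l1 := le_trans M1 lM.
have lb := greedy_prob_success r1 Dn l1 (uH n) (rH n).
set P := greedy_prob _ _ _.
have P1 : P <= 1.
  by rewrite -(greedy_probT R (H n)); apply: greedy_prob_le.
rewrite ger0_norm ?subr_ge0 // lerBlDl -lerBlDr; apply: le_trans lb.
rewrite lerD2l lerN2 ler_pdivrMr; last exact: lt_le_trans l1.
apply: (@le_trans _ _ (e * M)); last by rewrite ler_pM2l.
by rewrite /M mulrDr mulr1 mulrCA divff ?gt_eqF // mulr1 lerDr ltW.
Unshelve. all: by end_near.
Qed.
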